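(* Let $Z = m_1P_1+\cdots+m_iP_i+\cdots+m_sP_s \subseteq \mathbb{P}^n$ be a set of fat points, fix $i\in\{1,\dots,s\}$, and let $Z' = m_1P_1+\cdots+(m_i-1)P_i+\cdots+m_sP_s$. Suppose that $\deg_Z(P_i)=(d_1,\dots,d_\nu)$, where $\nu=\deg Z-\deg Z'$. Then: (a) For all $t\in\mathbb{N}$, $$\Delta H_{Z'}(t)=\Delta H_Z(t)-\left|\{\,j\in\{1,\dots,\nu\} \mid d_j=t\,\}\right|.$$ (b) If $$0\to \mathbb{F}_{n-1}\to\cdots\to\mathbb{F}_0\to I_Z\to 0$$ is a minimal graded free resolution of $I_Z$ over $R$, then the last syzygy module has the form $$\mathbb{F}_{n-1}\cong\mathbb{F}'_{n-1}\oplus R(-d_1-n)\oplus R(-d_2-n)\oplus\cdots\oplus R(-d_\nu-n)$$ for some graded free $R$-module $\mathbb{F}'_{n-1}$.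
   Context: $k$ is an algebraically closed field of characteristic zero, $n\ge 1$, and $R=k[x_0,\dots,x_n]$ with the standard grading, the homogeneous coordinate ring of $\mathbb{P}^n=\mathbb{P}^n_k$. For distinct points $P_1,\dots,P_s\in\mathbb{P}^n$ ($s \geq 1$) and positive integers $m_1,\dots,m_s$, the set of fat points $Z=m_1P_1+\cdots+m_sP_s$ is the scheme defined by $I_Z=I_{P_1}^{m_1}\cap\cdots\cap I_{P_s}^{m_s}$, where $I_{P_j}\subseteq R$ is the homogeneous prime ideal of $P_j$. Its degree is $\deg Z=\sum_{j=1}^s\binom{m_j+n-1}{n}$. The same notation is used for $Z'$; if $m_i-1=0$, the point $P_i$ is omitted from $Z'$ (and if no point remains, $I_{Z'}=R$ and $\deg Z'=0$). The Hilbert function of $Z$ is $H_Z(t)=\dim_k(R/I_Z)_t$ for $t \in \mathbb{N}$, with $H_Z(t)=0$ for $t<0$, and $\Delta H_Z(t)=H_Z(t)-H_Z(t-1)$; likewise for $Z'$. A separator of $P_i$ of multiplicity $m_i$ is a form $F$ with $F\in I_{P_i}^{m_i-1}\setminus I_{P_i}^{m_i}$ and $F\in I_{P_j}^{m_j}$ for all $j\ne i$. A minimal set of separators of $P_i$ of multiplicity $m_i$ is a set of $\nu=\deg Z-\deg Z'$ homogeneous polynomials $\{F_1,\dots,F_\nu\}$, each a separator of $P_i$ of multiplicity $m_i$, such that $I_{Z'}/I_Z=(\overline{F}_1,\dots,\overline{F}_\nu)$ in $R/I_Z$ and no set of fewer than $\nu$ elements generates $I_{Z'}/I_Z$. Such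 sets exist, and, after ordering so that $\deg F_1\le\cdots\le\deg F_\nu$, the tuple $\deg_Z(P_i):=(\deg F_1,\dots,\deg F_\nu)$ does not depend on the choice of the minimal set of separators; it is called the degree of the minimal separators of $P_i$ of multiplicity $m_i$. *)

(* Defs.v *)
From HB Require Import structures.
From mathcomp Require Import all_boot all_order all_algebra.
From mathcomp Require Import mpoly.
From mathcomp Require Import boolp.

Set Implicit Arguments.
Unset Strict Implicit.
Unset Printing Implicit Defensive.

Import GRing.Theory.
Local Open Scope ring_scope.

(** * Ideals, as Prop-valued predicates *)

Definition ideal_gen (A : comNzRingType) (S : A -> Prop) (f : A) : Prop :=
  exists (r : nat) (c g : 'I_r -> A),
    (forall j, S (g j)) /\ f = \sum_(j < r) c j * g j.

(* For m = 0 the only generator is the empty product, so the power is A. *)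
Definition ideal_pow (A : comNzRingType) (I : A -> Prop) (m : nat) : A -> Prop :=
  ideal_gen (fun f => exists g : 'I_m -> A,
    (forall j, I (g j)) /\ f = \prod_(j < m) g j).

(* The images of the G_j generate I / J, where J is contained in I; this also
   forces every G_j to lie in I. *)
Definition generates_quotient (A : comNzRingType) (I J : A -> Prop)
    (r : nat) (G : 'I_r -> A) : Prop :=
  forall f, I f <-> exists c : 'I_r -> A, J (f - \sum_(j < r) c j * G j).

(** * Projective points and fat points *)

(* A point of P^n is given by a nonzero vector of homogeneous coordinates. *)
Definition same_point (k : fieldType) (n : nat) (P Q : 'rV[k]_n.+1) : Prop :=
  exists2 c : k, c != 0 & P = c *: Q.

Definition point_ideal (k : fieldType) (n : nat) (P : 'rV[k]_n.+1) :
    {mpoly k[n.+1]} -> Prop :=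
  ideal_gen (fun f : {mpoly k[n.+1]} =>
    (exists d : nat, f \is d.-homog) /\ f.@[fun j => P 0 j] = 0).

(* Multiplicity 0 is allowed: such a point contributes neither to the ideal
   (I_P^0 = R) nor, for n >= 1, to the degree ('C(n - 1, n) = 0). *)
Definition fat_ideal (k : fieldType) (n s : nat) (P : 'I_s -> 'rV[k]_n.+1)
    (m : 'I_s -> nat) (f : {mpoly k[n.+1]}) : Prop :=
  forall j, ideal_pow (point_ideal (P j)) (m j) f.

Definition fat_degree (n s : nat) (m : 'I_s -> nat) : nat :=
  (\sum_(j < s) 'C(m j + n - 1, n))%N.

Definition lower_mult (s : nat) (m : 'I_s -> nat) (i : 'I_s) : 'I_s -> nat :=
  fun j => if j == i then (m j - 1)%N else m j.

(** * Hilbert functions *)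

(* dim_k (R / I)_t, as the largest size of a family of forms of degree t whose
   classes are linearly independent modulo the ideal I.  Such a family is
   independent in R_t, so the bound dim_k R_t on the index loses nothing. *)
Definition hilbert (k : fieldType) (n : nat) (I : {mpoly k[n.+1]} -> Prop)
    (t : nat) : nat :=
  (\max_(r < (\dim {: dhomog n.+1 k t}).+1 |
     `[< exists v : 'I_r -> dhomog n.+1 k t,
           forall c : 'I_r -> k,
             I (\sum_(j < r) c j *: mpoly_of_dhomog (v j))%R ->
             forall j, c j = 0%R >]) r)%N.

Definition first_difference (H : nat -> nat) (t : nat) : int :=
  (H t)%:Z - (if t is u.+1 then (H u)%:Z else 0).

(** * Separators *)

Section Separators.
Variables (k : fieldType) (n s : nat).
Variables (P : 'I_s -> 'rV[k]_n.+1) (m : 'I_s -> nat) (i : 'I_s).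

Definition separator (F : {mpoly k[n.+1]}) : Prop :=
  [/\ exists d : nat, F \is d.-homog,
      ideal_pow (point_ideal (P i)) (m i - 1) F,
      ~ ideal_pow (point_ideal (P i)) (m i) F
    & forall j, j != i -> ideal_pow (point_ideal (P j)) (m j) F].

Definition num_separators : nat :=
  (fat_degree n m - fat_degree n (lower_mult m i))%N.

Definition minimal_separators
    (F : 'I_num_separators -> {mpoly k[n.+1]}) : Prop :=
  let IZ := fat_ideal P m in
  let IZ' := fat_ideal P (lower_mult m i) in
  [/\ injective F,
      forall j, separator (F j),
      generates_quotient IZ' IZ F
    & forall (r : nat) (G : 'I_r -> {mpoly k[n.+1]}),
        (r < num_separators)%N -> ~ generates_quotient IZ' IZ G].

(* deg_Z(P_i) = d.  A separator is nonzero, so its degree is unique. *)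
Definition separator_degrees (d : num_separators.-tuple nat) : Prop :=
  sorted leq d /\
  exists F, minimal_separators F /\ forall j, F j \is (tnth d j).-homog.

End Separators.

(** * Graded free modules and minimal resolutions *)

(* A sequence a = [:: a_1; ...; a_r] of integers stands for the graded free
   module R(-a_1) + ... + R(-a_r) (direct sum), with basis elements in the
   degrees a_j. *)
Notation gfree k n a := 'rV[{mpoly k[n.+1]}]_(size a).

Definition form_of_degree (k : fieldType) (n : nat) (e : int)
    (f : {mpoly k[n.+1]}) : Prop :=
  if e is Posz d then f \is d.-homog else f = 0.

Definition gfree_homog (k : fieldType) (n : nat) (a : seq int) (e : int)
    (v : gfree k n a) : Prop :=
  forall j : 'I_(size a), form_of_degree (e - a`_j) (v 0 j).

Definition gfree_hom (k : fieldType) (n : nat) (a b : seq int)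
    (phi : {linear gfree k n a -> gfree k n b}) : Prop :=
  forall (e : int) (v : gfree k n a), gfree_homog e v -> gfree_homog e (phi v).

Definition gfree_iso (k : fieldType) (n : nat) (a b : seq int) : Prop :=
  exists phi : {linear gfree k n a -> gfree k n b},
    gfree_hom phi /\ bijective phi.

Definition irrelevant_ideal (k : fieldType) (n : nat) :
    {mpoly k[n.+1]} -> Prop :=
  ideal_gen (fun f => exists j : 'I_n.+1, f = 'X_j).

(* 0 -> F_(l-1) -> ... -> F_1 -> F_0 -> I -> 0, with differentials
   d i : F_(i+1) -> F_i and augmentation eps.  The family F is extended by zero
   modules from the index l on, so that exactness at F_(l-1) is injectivity of
   its outgoing map. *)
Record minimal_resolution (k : fieldType) (n : nat)
    (I : {mpoly k[n.+1]} -> Prop) (l : nat) (F : nat -> seq int)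
    (d : forall i, {linear gfree k n (F i.+1) -> gfree k n (F i)})
    (eps : {linear gfree k n (F 0%N) -> {mpoly k[n.+1]}^o}) : Prop := {
  resolution_length : forall i, (l <= i)%N -> F i = [::];
  resolution_hom : forall i, gfree_hom (d i);
  augmentation_hom : forall (e : int) (v : gfree k n (F 0%N)),
    gfree_homog e v -> form_of_degree e (eps v : {mpoly k[n.+1]});
  augmentation_image : forall f : {mpoly k[n.+1]},
    I f <-> exists v, eps v = f;
  exact_at_0 : forall v, eps v = 0 <-> exists w, d 0%N w = v;
  exact_at_succ : forall i v, d i v = 0 <-> exists w, d i.+1 w = v;
  resolution_minimal : forall i w (j : 'I_(size (F i))),
    irrelevant_ideal (d i w 0 j)
}.

(* Main.v *)
Require Import Defs.
From HB Require Import structures.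
From mathcomp Require Import all_boot all_order all_algebra.
From mathcomp Require Import mpoly.
From mathcomp Require Import boolp perm zify ring.

Set Implicit Arguments.
Unset Strict Implicit.
Unset Printing Implicit Defensive.

Import GRing.Theory.
Local Open Scope ring_scope.

(* Write I and I' for the ideals of Z and Z', and P for P_i. Since I_P I' lies in
   I, the module M = I'/I is a module over R/I_P = k[L], where L is a linear form
   vanishing at no P_j. As L is regular on R/I, minimality of the separators makes
   them a k[L]-basis of M, hence dim M_t = #{j | d_j <= t}, which is (a).

   For (b), no Tor is needed. Let y_0 = L, y_1, ..., y_n be linear forms with
   y_1, ..., y_n generating I_P, let a_p = (y_0, ..., y_p), and let G be the
   resolution of R/I, so that G_(p+1) = F_p. A separator x_0 = F_j in G_0 = R
   satisfies y_l x_0 \in I for l >= 1; solving y_(p+1) x_p = D x_(p+1) modulo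
   a_p G_p successively yields x_n in G_n = F_(n-1), homogeneous of degree d_j + n.
   Regularity of y_0, ..., y_n allows one to go backwards: if a combination of the
   x_n lies in a_n G_n, then the same combination of the separators lies in
   I + (L), which forces it to vanish. So the x_n of degree e + n are independent
   modulo the irrelevant ideal, and F_(n-1) has enough generators of that degree. *)

Local Notation pihomog := (@pihomog _ _ mdeg).

(** * Ideals *)

Record is_ideal (A : comNzRingType) (I : A -> Prop) : Prop := {
  ideal0 : I 0;
  idealD : forall x y, I x -> I y -> I (x + y);
  ideal_mull : forall a x, I x -> I (a * x)
}.

Section IdealTheory.
Variables (A : comNzRingType) (I : A -> Prop).
Hypothesis I_ideal : is_ideal I.

Lemma ideal_mulr a x : I x -> I (x * a).
Proof. by rewrite mulrC; apply: ideal_mull. Qed.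

Lemma idealN x : I x -> I (- x).
Proof. by rewrite -mulN1r; apply: ideal_mull. Qed.

Lemma idealB x y : I x -> I y -> I (x - y).
Proof. by move=> Ix Iy; apply: idealD => //; apply: idealN. Qed.

Lemma ideal_sum (J : Type) (r : seq J) (Q : pred J) (F : J -> A) :
  (forall j, Q j -> I (F j)) -> I (\sum_(j <- r | Q j) F j).
Proof. by move=> IF; elim/big_ind: _ => //; [apply: ideal0|apply: idealD]. Qed.

End IdealTheory.

Lemma ideal_gen_ideal (A : comNzRingType) (S : A -> Prop) :
  is_ideal (ideal_gen S).
Proof.
split=> [|x y [r1 [c1 [g1 [S1 ->]]]] [r2 [c2 [g2 [S2 ->]]]]|].
- exists 0%N, (fun=> 0), (fun=> 0); split; first by case.
  by rewrite big_ord0.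
- exists (r1 + r2)%N, (fun j => match split j with inl a => c1 a | inr b => c2 b end).
  exists (fun j => match split j with inl a => g1 a | inr b => g2 b end).
  split=> [j|]; first by case: (split j).
  rewrite big_split_ord; congr (_ + _); apply: eq_bigr => j _.
    by rewrite (unsplitK (inl j)).
  by rewrite (unsplitK (inr j)).
- move=> a x [r [c [g [Sg ->]]]]; exists r, (fun j => a * c j), g; split=> //.
  by rewrite mulr_sumr; apply: eq_bigr => j _; rewrite mulrA.
Qed.

Lemma mem_ideal_gen (A : comNzRingType) (S : A -> Prop) x : S x -> ideal_gen S x.
Proof.
move=> Sx; exists 1%N, (fun=> 1), (fun=> x); split=> //.
by rewrite big_ord1 mul1r.
Qed.

(** * Supports and homogeneous components *)

Section Support.
Variables (N : nat) (k : fieldType).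
Local Notation R := {mpoly k[N]}.
Implicit Types (f g : R) (Q : pred 'X_{1..N}).

(** Membership in a monomial ideal is a condition on supports. Every ideal met below becomes one of
    this kind after a linear change of coordinates, so that membership, homogeneity and regularity
    can be read off exponents. *)
Definition supp_in Q f := forall e, e \in msupp f -> Q e.

Lemma supp_in0 Q : supp_in Q 0.
Proof. by move=> e; rewrite msupp0. Qed.

Lemma supp_inD Q f g : supp_in Q f -> supp_in Q g -> supp_in Q (f + g).
Proof.
by move=> Qf Qg e /msuppD_le; rewrite mem_cat => /orP[/Qf|/Qg].
Qed.

Lemma supp_inZ Q c f : supp_in Q f -> supp_in Q (c *: f).
Proof. by move=> Qf e /msuppZ_le /Qf. Qed.

Lemma supp_inM Q1 Q2 Q f g : (forall a b, Q1 a -> Q2 b -> Q (a + b)%MM) ->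
  supp_in Q1 f -> supp_in Q2 g -> supp_in Q (f * g).
Proof.
move=> Q12 Qf Qg e /msuppM_le /allpairsP[[a b] /= [/Qf Qa /Qg Qb ->]].
exact: Q12.
Qed.

Lemma supp_in_ideal Q : (forall a b, Q b -> Q (a + b)%MM) ->
  is_ideal (supp_in Q : R -> Prop).
Proof.
move=> Qup; split; [exact: supp_in0|exact: supp_inD|move=> f g Qg].
by apply: (@supp_inM predT Q) Qg => // a b _; apply: Qup.
Qed.

Lemma supp_inXM Q m f :
  supp_in Q ('X_[m] * f) <-> supp_in (fun e => Q (m + e)%MM) f.
Proof.
split=> Qf e; rewrite ?mcoeff_msupp => fe.
  by apply: Qf; rewrite mcoeff_msupp mulrC mcoeffMX.
have: e \in msupp (f * 'X_[m]) by rewrite mulrC mcoeff_msupp.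
by rewrite (perm_mem (msuppMX f m)) => /mapP[e' /Qf Qe' ->].
Qed.

Lemma mcoeff_pihomog d f e : (pihomog d f)@_e = if mdeg e == d then f@_e else 0.
Proof.
rewrite [f in RHS]mpolyE pihomogE !raddf_sum /= big_mkcond /=.
case: ifP => de; last first.
  rewrite big1 // => m _; case: ifP => // dm; rewrite mcoeffZ mcoeffX.
  by case: eqP => [em|_]; [rewrite -em dm in de|rewrite mulr0].
apply: eq_bigr => m _; case: ifP => // dm; rewrite mcoeffZ mcoeffX.
by case: eqP => [em|_]; [rewrite em de in dm|rewrite mulr0].
Qed.

Lemma supp_in_pihomog Q d f : supp_in Q f -> supp_in Q (pihomog d f).
Proof.
move=> Qf e; rewrite mcoeff_msupp mcoeff_pihomog; case: ifP => // _.
  by rewrite -mcoeff_msupp => /Qf.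
by rewrite eqxx.
Qed.

Lemma pihomogM d e f g : g \is e.-homog ->
  pihomog (d + e) (f * g) = pihomog d f * g.
Proof.
(* The bound exceeds [d] as well, so that the component of degree [d] occurs in the decomposition
   even when [d] is beyond the degree of [f]. *)
move=> hg; set l := maxn (msize f) d.+1.
have hl : (msize f <= l)%N by exact: leq_maxl.
rewrite {1}(pihomog_partitionE (mf := mdeg) hl) mulr_suml linear_sum /=.
have dl : (d < l)%N by rewrite /l leq_max leqnn orbT.
rewrite (bigD1 (Ordinal dl)) //= big1 ?addr0 => [|j jd].
  by rewrite pihomog_dE //; apply: dhomogM => //; apply: pihomogP.
apply: (@pihomog_ne0 _ _ _ (j + e)%N).
  by rewrite eqn_add2r; apply: contraNneq jd => jd; apply/eqP/val_inj.
by apply: dhomogM => //; apply: pihomogP.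
Qed.

Lemma pihomogM_small d e f g : g \is e.-homog -> (d < e)%N ->
  pihomog d (f * g) = 0.
Proof.
move=> hg de; have hl : (msize f <= msize f)%N by [].
rewrite {1}(pihomog_partitionE (mf := mdeg) hl) mulr_suml linear_sum /=.
rewrite big1 // => j _; apply: (@pihomog_ne0 _ _ _ (j + e)%N).
  by rewrite neq_ltn (leq_trans de) ?leq_addl // orbT.
by apply: dhomogM => //; apply: pihomogP.
Qed.

End Support.

(** * Linear changes of coordinates *)

Section LinSubst.
Variables (N : nat) (k : fieldType).
Local Notation R := {mpoly k[N]}.
Implicit Types (A B : 'M[k]_N) (f g : R).

Definition linear_form (c : 'rV[k]_N) : R := \sum_j c 0 j *: 'X_j.

Lemma linear_form_homog c : linear_form c \is 1.-homog.
Proof.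
by apply: rpred_sum => j _; apply: rpredZ; rewrite dhomogX; apply/eqP/mdeg1.
Qed.

Lemma linear_form_eval c v : (linear_form c).@[v] = \sum_j c 0 j * v j.
Proof.
by rewrite raddf_sum /=; apply: eq_bigr => j _; rewrite mevalZ mevalXU.
Qed.

Lemma linear_formZ a c : linear_form (a *: c) = a *: linear_form c.
Proof.
by rewrite scaler_sumr; apply: eq_bigr => j _; rewrite mxE scalerA.
Qed.

Lemma linear_form_delta i : linear_form (delta_mx 0 i) = 'X_i.
Proof.
rewrite /linear_form (bigD1 i) //= big1 ?addr0 => [|j /negPf ji].
  by rewrite mxE !eqxx scale1r.
by rewrite mxE ji andbF scale0r.
Qed.

Definition lin_subst A f : R := f \mPo [tuple linear_form (row i A) | i < N].

Lemma lin_substX A i : lin_subst A 'X_i = linear_form (row i A).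
Proof.
by rewrite /lin_subst comp_mpolyXU -tnth_nth tnth_mktuple.
Qed.

HB.instance Definition _ A := GRing.RMorphism.copy (lin_subst A)
  (comp_mpoly [tuple linear_form (row i A) | i < N]).
HB.instance Definition _ A := GRing.Linear.copy (lin_subst A)
  (comp_mpoly [tuple linear_form (row i A) | i < N]).

Lemma lin_subst_linear_form A c : lin_subst A (linear_form c) = linear_form (c *m A).
Proof.
rewrite linear_sum /=; under eq_bigr do rewrite linearZ /= lin_substX scaler_sumr.
rewrite exchange_big; apply: eq_bigr => j _ /=.
rewrite [in RHS]mxE scaler_suml.
by apply: eq_bigr => l _; rewrite scalerA mxE.
Qed.

Lemma lin_substXm A m :
  lin_subst A 'X_[m] = \prod_(i < N) linear_form (row i A) ^+ m i.
Proof.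
rewrite /lin_subst comp_mpolyX; apply: eq_bigr => i _.
by rewrite tnth_mktuple.
Qed.

Lemma lin_subst_comp A B f : lin_subst A (lin_subst B f) = lin_subst (B *m A) f.
Proof.
rewrite [f]mpolyE (linear_sum (lin_subst B)) (linear_sum (lin_subst (B *m A))).
rewrite (linear_sum (lin_subst A)) /=; apply: eq_bigr => m _; rewrite !linearZ /=.
congr (_ *: _); rewrite !lin_substXm rmorph_prod; apply: eq_bigr => i _ /=.
by rewrite rmorphXn /= lin_subst_linear_form row_mul.
Qed.

Lemma lin_subst1 f : lin_subst 1%:M f = f.
Proof.
rewrite -[RHS]comp_mpoly_id; congr (_ \mPo _); apply: eq_mktuple => i.
by rewrite rowE mulmx1 linear_form_delta.
Qed.

Lemma lin_substK A : A \in unitmx -> cancel (lin_subst A) (lin_subst (invmx A)).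
Proof. by move=> uA f; rewrite lin_subst_comp mulmxV // lin_subst1. Qed.

Lemma lin_substKV A : A \in unitmx -> cancel (lin_subst (invmx A)) (lin_subst A).
Proof. by move=> uA f; rewrite lin_subst_comp mulVmx // lin_subst1. Qed.

Lemma lin_subst_homog A d f : f \is d.-homog -> lin_subst A f \is d.-homog.
Proof.
move=> /dhomogP hf; rewrite [f]mpolyE linear_sum big_seq /=.
apply: rpred_sum => m mf; rewrite linearZ /= lin_substXm; apply: rpredZ.
(* The factors [1 *] match the degree that [dhomogMn] assigns to a power of a linear form. *)
have <- : (\sum_(i < N) 1 * m i)%N = d.
  transitivity (mdeg m); last exact: hf.
  by rewrite mdegE; apply: eq_bigr => i _; rewrite mul1n.
elim/big_rec2: _ => [|i d' p _ hp]; first exact: dhomog1.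
by apply: dhomogM => //; apply: dhomogMn; apply: linear_form_homog.
Qed.

Lemma lin_subst_pihomog A d f :
  lin_subst A (pihomog d f) = pihomog d (lin_subst A f).
Proof.
set l := maxn (msize f) d.+1.
have hl : (msize f <= l)%N by exact: leq_maxl.
have E : lin_subst A f = \sum_(j < l) lin_subst A (pihomog j f).
  by rewrite -linear_sum -pihomog_partitionE.
have -> : pihomog d (lin_subst A f) = \sum_(j < l) pihomog d (lin_subst A (pihomog j f)).
  by rewrite E linear_sum.
have dl : (d < l)%N by rewrite /l leq_max leqnn orbT.
rewrite (bigD1 (Ordinal dl)) //= big1 ?addr0 => [|j jd].
  by rewrite [RHS]pihomog_dE //; apply: lin_subst_homog; apply: pihomogP.
apply: (@pihomog_ne0 _ _ _ j).
  by apply: contraNneq jd => jd; apply/eqP/val_inj.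
by apply: lin_subst_homog; apply: pihomogP.
Qed.

Lemma lin_subst_eval A f v :
  (lin_subst A f).@[v] = f.@[fun i => \sum_j A i j * v j].
Proof.
rewrite comp_mpoly_meval; apply: meval_eq => i; rewrite tnth_mktuple.
by rewrite linear_form_eval; apply: eq_bigr => j _; rewrite mxE.
Qed.

End LinSubst.

(** * Powers of the ideal of a point *)

Section PointIdeal.
Variables (k : fieldType) (n : nat).
Local Notation R := {mpoly k[n.+1]}.

(* In coordinates where the point is [1 : 0 : ... : 0], the order of vanishing
   of the monomial at the point. *)
Definition vdeg (e : 'X_{1..n.+1}) : nat := (\sum_(j < n) e (lift ord0 j))%N.

Lemma vdegD a b : vdeg (a + b)%MM = (vdeg a + vdeg b)%N.
Proof. by rewrite -big_split; apply: eq_bigr => j _; rewrite mnmDE. Qed.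

Lemma mdeg_vdeg e : mdeg e = (e ord0 + vdeg e)%N.
Proof. by rewrite mdegE big_ord_recl. Qed.

Lemma vdeg_U0 : vdeg U_(ord0) = 0%N.
Proof. by rewrite /vdeg big1 // => j _; rewrite mnm1E. Qed.

Lemma vdeg_U j : vdeg U_(lift ord0 j) = 1%N.
Proof.
apply/eqP; rewrite -(eqn_add2l (U_(lift ord0 j)%MM ord0)).
by rewrite -mdeg_vdeg mdeg1 mnm1E.
Qed.

Lemma vdeg_eq0 e : vdeg e = 0%N -> e = (U_(ord0) *+ mdeg e)%MM.
Proof.
move=> e0; apply/mnmP => i; rewrite mulmnE mnm1E mdeg_vdeg e0 addn0.
case: (unliftP ord0 i) => [j ->|->]; last by rewrite eqxx mul1n.
rewrite eq_liftF mul0n; apply/eqP.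
by move/eqP: e0; rewrite sum_nat_eq0 => /forallP/(_ j).
Qed.

Lemma vdeg_ideal m : is_ideal (supp_in (fun e => m <= vdeg e)%N : R -> Prop).
Proof.
apply: supp_in_ideal => a b mb; rewrite vdegD; exact: leq_trans mb (leq_addl _ _).
Qed.

(** At [1 : 0 : ... : 0] only pure powers of the first variable survive, and a form of degree [d]
    contains at most one of them. *)
Lemma eval_e0 (f : R) d : f \is d.-homog ->
  f.@[fun j => (j == ord0)%:R] = f@_(U_(ord0) *+ d).
Proof.
move=> /dhomogP hf; rewrite mevalE.
have E (m : 'X_{1..n.+1}) : \prod_i ((i == ord0)%:R : k) ^+ m i = (vdeg m == 0%N)%:R.
  rewrite big_ord_recl expr1n mul1r.
  rewrite (eq_bigr (fun j => (m (lift ord0 j) == 0%N)%:R)); last first.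
    by move=> j _; rewrite expr0n.
  have [/eqP|] := boolP (vdeg m == 0%N).
    move/eqP; rewrite sum_nat_eq0 => /forallP /= m0.
    by rewrite big1 // => j _; rewrite (eqP (m0 j)) eqxx.
  rewrite sum_nat_eq0 negb_forall => /existsP[j /= mj].
  by rewrite (bigD1 j) //= (negPf mj) mul0r.
have [ef|ef] := boolP ((U_(ord0) *+ d)%MM \in msupp f).
  rewrite (bigD1_seq _ ef) ?msupp_uniq //= E big_seq_cond big1 ?addr0.
    suff -> : vdeg (U_(ord0) *+ d)%MM = 0%N by rewrite mulr1.
    by rewrite /vdeg big1 // => j _; rewrite mulmnE mnm1E.
  move=> m /andP[/hf dm me]; rewrite E; case: eqP => [/vdeg_eq0 e0|_].
    by rewrite e0 -dm eqxx in me.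
  by rewrite mulr0.
rewrite (memN_msupp_eq0 ef) big_seq big1 // => m mf; rewrite E.
case: eqP => [/vdeg_eq0 e0|_]; last by rewrite mulr0.
by move: (mf); rewrite e0 (hf _ mf : mdeg m = d) (negPf ef).
Qed.

(** Substituting with [A] moves the point [P] to [1 : 0 : ... : 0] and turns the linear form [c]
    into [lam] times the first variable, simultaneously. *)
Lemma adapted_matrix (c P : 'rV[k]_n.+1) (lam : k) : c 0 0 != 0 -> lam != 0 ->
  \sum_j c 0 j * P 0 j = lam ->
  exists A : 'M[k]_n.+1, [/\ A \in unitmx, (forall j, A j 0 = P 0 j)
    & c *m A = lam *: delta_mx 0 0].
Proof.
move=> c0 lam0 cP.
(* The columns after the first are [e_j - (c_j / c_0) e_0], a basis of the kernel of [c]; the first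
   column [P] lies outside this kernel because [lam] is nonzero. *)
pose A : 'M[k]_n.+1 := \matrix_(l, j) if j == 0 then P 0 l
  else if l == 0 then - c 0 j / c 0 0 else (l == j)%:R.
pose q (i : 'I_n.+1) := if i == 0 then lam^-1 else - P 0 i / lam.
(* The inverse of [A]: its first row is [c / lam], and row [i] is [e_i - (P_i / lam) c], the
   projection along [P]. *)
pose B : 'M[k]_n.+1 := \matrix_(i, l) ((i != 0)%:R * (i == l)%:R + q i * c 0 l).
have cA : c *m A = lam *: delta_mx 0 0.
  apply/rowP => j; rewrite !mxE eqxx /=; have [->|j0] := eqVneq j 0.
    by rewrite mulr1 -cP; apply: eq_bigr => l _; rewrite mxE eqxx.
  rewrite mulr0 big_ord_recl mxE (negPf j0) eqxx mulrCA mulfV // mulr1.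
  case: (unliftP ord0 j) j0 => [j' ->|->] //= _.
  rewrite (bigD1 j') //= mxE eqxx mulr1 big1 ?addr0 ?addNr // => l lj.
  by rewrite mxE /= (inj_eq lift_inj) (negPf lj) mulr0.
exists A; split=> //; last by move=> j; rewrite mxE eqxx.
have BA : B *m A = 1%:M.
  apply/matrixP => i j; rewrite !mxE.
  under eq_bigr do rewrite mxE mulrDl -mulrA -mulrA.
  rewrite big_split -!mulr_sumr /=.
  have -> : \sum_l c 0 l * A l j = lam * (j == 0)%:R.
    by move/rowP: cA => /(_ j); rewrite !mxE eqxx.
  rewrite (bigD1 i) //= eqxx mul1r big1 ?addr0; last first.
    by move=> l; rewrite eq_sym => /negPf ->; rewrite mul0r.
  rewrite /q mxE; have [->|i0] := eqVneq i 0.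
    by rewrite mul0r add0r mulrA mulVf // mul1r eq_sym.
  rewrite mul1r; have [->|j0] := eqVneq j 0.
    by rewrite mulr1 mulfVK // subrr (negPf i0).
  by rewrite !mulr0 addr0.
by have [] := mulmx1_unit BA.
Qed.

Section Adapted.
Variables (P : 'rV[k]_n.+1) (A : 'M[k]_n.+1).
Hypotheses (uA : A \in unitmx) (A_P : forall j, A j 0 = P 0 j).

Lemma adapted_eval f : (lin_subst A f).@[fun j => (j == ord0)%:R] = f.@[fun j => P 0 j].
Proof.
rewrite lin_subst_eval; apply: meval_eq => i.
by rewrite (bigD1 ord0) //= mulr1 A_P big1 ?addr0 // => j /negPf->; rewrite mulr0.
Qed.

(** A monomial of order 0 is a pure power of the first variable, and in a homogeneous generator its
    coefficient is the value at [P], which vanishes. *)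
Lemma point_ideal_vdeg (f : R) :
  point_ideal P f -> supp_in (fun e => 1 <= vdeg e)%N (lin_subst A f).
Proof.
move=> [r [c [g [Sg ->]]]]; rewrite (linear_sum (lin_subst A)) /=.
apply: (ideal_sum (vdeg_ideal 1)) => j _; rewrite rmorphM /=.
apply: (ideal_mull (vdeg_ideal 1)).
have [[d hg] gP] := Sg j; have hAg := lin_subst_homog A hg.
move=> e; rewrite mcoeff_msupp lt0n; apply: contraNneq => /vdeg_eq0 ->.
have [de|de] := eqVneq (mdeg e) d; first by rewrite de -eval_e0 // adapted_eval gP.
by apply/eqP/(dhomog_nemf_coeff hAg); rewrite /= mdegMn mdeg1 mul1n.
Qed.

Lemma point_ideal_coord j : point_ideal P (lin_subst (invmx A) 'X_(lift ord0 j)).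
Proof.
apply: mem_ideal_gen; split.
  by exists 1%N; apply: lin_subst_homog; rewrite dhomogX; apply/eqP/mdeg1.
by rewrite -adapted_eval lin_substKV // mevalXU.
Qed.

(** In adapted coordinates the ideal of the point is generated by all variables but the first, so
    its powers are monomial ideals. *)
Lemma ideal_pow_vdeg m (f : R) : ideal_pow (point_ideal P) m f <->
  supp_in (fun e => m <= vdeg e)%N (lin_subst A f).
Proof.
split.
  move=> [r [c [g [Sg ->]]]]; rewrite (linear_sum (lin_subst A)) /=.
  apply: (ideal_sum (vdeg_ideal m)) => j _; rewrite rmorphM /=.
  apply: (ideal_mull (vdeg_ideal m)); have [h [hP ->]] := Sg j.
  elim: m h hP {c g Sg} => [|m IH] h hP; first by move=> e _.
  rewrite big_ord_recl rmorphM /=.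
  apply: supp_inM (point_ideal_vdeg (hP ord0)) (IH _ (fun j => hP (lift ord0 j))).
  by move=> a b; rewrite vdegD -add1n; apply: leq_add.
move=> hf; rewrite -[f](lin_substK uA) [X in lin_subst (invmx A) X]mpolyE.
rewrite (linear_sum (lin_subst (invmx A))) big_seq /=.
apply: (ideal_sum (ideal_gen_ideal _)) => e /hf; rewrite linearZ /= -mul_mpolyC.
move=> me; apply: (ideal_mull (ideal_gen_ideal _)).
suff [g [gP [u ->]]] : exists g : 'I_m -> R, (forall j, point_ideal P (g j)) /\
    exists u, lin_subst (invmx A) 'X_[e] = u * \prod_(j < m) g j.
  by apply: (ideal_mull (ideal_gen_ideal _)); apply: mem_ideal_gen; exists g.
(* One variable other than the first is split off from the monomial at each step; the quotient is
   collected in [u]. *)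
elim: m e me {hf} => [|m IH] e me.
  exists (fun=> 0); split; first by case.
  by exists (lin_subst (invmx A) 'X_[e]); rewrite big_ord0 mulr1.
have /existsP[j ej] : [exists j, e (lift ord0 j) != 0%N].
  apply: contraLR me; rewrite negb_exists -leqNgt => /forallP e0.
  by rewrite [vdeg e]big1 // => j _; apply/eqP; rewrite -[_ == _]negbK.
have eU : (U_(lift ord0 j) <= e)%MM.
  by apply/mnm_lepP => l; rewrite mnm1E; case: eqP => // <-; rewrite lt0n.
have [|g [gP [u hu]]] := IH (e - U_(lift ord0 j))%MM.
  by rewrite -ltnS (leq_trans me) // -{1}(submK eU) vdegD vdeg_U addn1.
exists (fun l => if unlift ord0 l is Some l' then g l'
  else lin_subst (invmx A) 'X_(lift ord0 j)); split.
  by move=> l; case: unliftP => // _; apply: point_ideal_coord.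
exists u; rewrite big_ord_recl unlift_none.
under [in RHS]eq_bigr do rewrite liftK.
by rewrite mulrCA -hu -rmorphM -mpolyXD addmC submK.
Qed.

End Adapted.
End PointIdeal.

(** * Hilbert functions *)

(** Turns coefficients indexed by ['I_#|A|] into coefficients on the whole type, so that sums over
    [A] can be reindexed freely. *)
Lemma extend_enum_val (T : finType) (A : {pred T}) (k : nmodType)
    (c : 'I_#|A| -> k) : exists a : T -> k, forall i, a (enum_val i) = c i.
Proof.
exists (fun j => if [pick i | enum_val i == j] is Some i then c i else 0) => i.
case: pickP => [l /eqP/enum_val_inj -> //|/(_ i)].
by rewrite eqxx.
Qed.

(** Independence modulo [U] makes [X] free and its span disjoint from [U], so the dimensions add
    up. *)
Lemma dim_span_add (k : fieldType) (V : vectType k) (U : {vspace V}) r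
    (X : r.-tuple V) :
  (forall c : 'I_r -> k, \sum_j c j *: tnth X j \in U -> forall j, c j = 0) ->
  \dim (<<X>> + U) = (r + \dim U)%N.
Proof.
move=> indep.
have freeX : free X.
  apply/freeP => c c0; apply: indep.
  by under eq_bigr do rewrite (tnth_nth 0); rewrite c0 mem0v.
rewrite dimv_disjoint_sum; last first.
  apply/eqP; rewrite -subv0; apply/subvP => w; rewrite memv_cap memv0 => /andP[wX].
  rewrite (coord_span wX) => wU; rewrite big1 // => j _.
  rewrite (indep (fun j => coord X j w)) ?scale0r //.
  by under eq_bigr do rewrite (tnth_nth 0).
by move/eqP: freeX => ->; rewrite size_tuple.
Qed.

Section Hilbert.
Variables (k : fieldType) (n : nat).
Local Notation R := {mpoly k[n.+1]}.
Variables (I : R -> Prop).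
Hypothesis I_ideal : is_ideal I.

Lemma idealZ c f : I f -> I (c *: f).
Proof. by rewrite -mul_mpolyC; apply: ideal_mull. Qed.

(** [I] is only a predicate, so the subspace is found as one of maximal dimension inside [I]: a form
    of [I] outside it would enlarge it. *)
Lemma graded_piece t : exists U : {vspace dhomog n.+1 k t},
  forall v, v \in U <-> I (mpoly_of_dhomog v).
Proof.
pose D := \dim {: dhomog n.+1 k t}.
pose Q r := `[< exists U : {vspace dhomog n.+1 k t}, \dim U = r /\
  forall v, v \in U -> I (mpoly_of_dhomog v) >].
have Q0 : exists r, Q r.
  exists 0%N; apply/asboolP; exists 0%VS; rewrite dimv0; split=> // v.
  by rewrite memv0 => /eqP ->; rewrite linear0; apply: ideal0.
have QD r : Q r -> (r <= D)%N.
  by move=> /asboolP[U [<- _]]; apply/dimvS/subvf.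
case: (ex_maxnP Q0 QD) => r /asboolP[U [dimU UI]] maxr; exists U => v.
split=> [/UI //|Iv]; apply/negPn/negP => vU.
suff : (r.+1 <= r)%N by rewrite ltnn.
apply: maxr; apply/asboolP; exists (<<[tuple v]>> + U)%VS; split.
  rewrite dim_span_add ?dimU // => c; rewrite big_ord1 => cU j.
  rewrite (ord1 j); apply/eqP; apply: contraR vU => c0.
  by move: cU; rewrite rpredZeq (negPf c0).
move=> w /memv_addP[x]; rewrite span_seq1 => /vlineP[c ->] [y /UI yI ->].
by rewrite linearP; apply: idealD => //; apply: idealZ.
Qed.

(** By [dim_span_add], a family independent modulo [U] has at most the codimension of [U] as its
    size; a basis of a complement attains this bound. *)
Lemma hilbert_dim t (U : {vspace dhomog n.+1 k t}) :
  (forall v, v \in U <-> I (mpoly_of_dhomog v)) ->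
  (hilbert I t + \dim U)%N = \dim {: dhomog n.+1 k t}.
Proof.
move=> UI; set D := \dim {: _}.
have UD : (\dim U <= D)%N by apply/dimvS/subvf.
suff -> : hilbert I t = (D - \dim U)%N by rewrite subnK.
have sumE r (c : 'I_r -> k) (v : 'I_r -> dhomog n.+1 k t) :
    \sum_(j < r) c j *: mpoly_of_dhomog (v j) =
    mpoly_of_dhomog (\sum_(j < r) c j *: v j).
  by rewrite linear_sum; apply: eq_bigr => j _; rewrite linearZ.
apply/eqP; rewrite eqn_leq; apply/andP; split.
  apply/bigmax_leqP => r /asboolP[v indep].
  rewrite leq_subRL // addnC -(@dim_span_add _ _ U _ [tuple v j | j < r]).
    exact/dimvS/subvf.
  move=> c; under eq_bigr do rewrite tnth_mktuple.
  by move=> /UI; rewrite -sumE; apply: indep.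
have rD : (D - \dim U < D.+1)%N by rewrite ltnS leq_subr.
apply: (@leq_bigmax_cond _ _ _ (Ordinal rD)); apply/asboolP => /=.
have dimC : \dim U^C = (D - \dim U)%N by rewrite dimv_compl.
rewrite -dimC; exists (fun j => tnth (vbasis U^C) j) => c.
rewrite sumE => /UI cU; have /freeP fr := basis_free (vbasisP U^C); apply: fr.
under eq_bigr do rewrite -tnth_nth.
apply/eqP; rewrite -memv0 -(capv_compl U) memv_cap cU /=.
by apply: rpred_sum => j _; apply: rpredZ; apply/vbasis_mem/mem_tnth.
Qed.

End Hilbert.

(** * The module of separators *)

(** A relation with an invertible coefficient at [j0] expresses [F j0] through the other generators,
    which [lift j0] enumerates. *)
Lemma drop_generator (A : comNzRingType) (I I' : A -> Prop) nu (F c : 'I_nu -> A) u j0 :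
  is_ideal I -> is_ideal I' -> (forall f, I f -> I' f) -> (forall j, I' (F j)) ->
  (forall f, I' f -> exists b, I (f - \sum_j b j * F j)) ->
  I (\sum_j c j * F j) -> u * c j0 = 1 ->
  exists r (G : 'I_r -> A), (r < nu)%N /\ generates_quotient I' I G.
Proof.
case: nu F c j0 => [|r] F c j0; first by case: j0.
move=> I_ideal I'_ideal I_sub F_I' F_gen Ic uc.
exists r, (fun l => F (lift j0 l)); split=> // f; split; last first.
  move=> [b /I_sub If]; rewrite -[f](subrK (\sum_(j < r) b j * F (lift j0 j))).
  by apply: idealD => //; apply: ideal_sum => // j _; apply: ideal_mull.
move=> /F_gen[b Ib]; exists (fun l => b (lift j0 l) - b j0 * u * c (lift j0 l)).
have := idealD I_ideal Ib (ideal_mull I_ideal (b j0 * u) Ic).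
rewrite !(bigD1_ord j0) //= [X in _ + X]mulrDr (mulrA _ (c j0)) -(mulrA _ u) uc mulr1.
rewrite [X in I _ -> I (_ - X)](eq_bigr (fun l => b (lift j0 l) * F (lift j0 l)
  - b j0 * u * (c (lift j0 l) * F (lift j0 l)))); last first.
  by move=> l _; rewrite mulrBl !mulrA.
rewrite sumrB -mulr_sumr; congr I; ring.
Qed.

Section SeparatorModule.
Variables (k : fieldType) (n : nat).
Local Notation R := {mpoly k[n.+1]}.
Variables (I I' : R -> Prop) (L : R) (nu : nat) (F : 'I_nu -> R) (d : 'I_nu -> nat).
Hypotheses (I_ideal : is_ideal I) (I'_ideal : is_ideal I').
Hypothesis I_homog : forall t f, I f -> I (pihomog t f).
Hypotheses (L_homog : L \is 1.-homog)
  (L_sat : forall f, I (L * f) -> I f) (L_sat' : forall f, I' (L * f) -> I' f).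
Hypotheses (F_homog : forall j, F j \is (d j).-homog) (F_I' : forall j, I' (F j)).
Hypothesis I_sub : forall f, I f -> I' f.
Hypothesis F_gen : forall f, I' f -> exists c, I (f - \sum_j c j * F j).
Hypothesis F_min : forall r (G : 'I_r -> R), (r < nu)%N -> ~ generates_quotient I' I G.
Hypothesis form_act : forall e g, g \is e.-homog ->
  exists a : k, forall j, I ((g - a *: L ^+ e) * F j).

Lemma Lexp_sat e f : I (L ^+ e * f) -> I f.
Proof. by elim: e => [|e IH]; rewrite ?mul1r // exprS -mulrA => /L_sat. Qed.

(** In degree [t] only the component of degree [t - d j] of the coefficient of [F j] matters, and
    [form_act] replaces it by a scalar multiple of a power of [L]. *)
Lemma separators_span t f : f \is t.-homog -> I' f ->
  exists a : 'I_nu -> k, I (f - \sum_(j | (d j <= t)%N) a j *: (L ^+ (t - d j) * F j)).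
Proof.
move=> hf /F_gen[c If].
have /fin_all_exists[a Ia] j : exists aj : k, forall l,
    I ((pihomog (t - d j) (c j) - aj *: L ^+ (t - d j)) * F l).
  by apply: form_act; apply: pihomogP.
exists a; have := I_homog t If; rewrite linearB (linear_sum (pihomog t)) /= pihomog_dE //.
rewrite [X in _ - X](bigID (fun j => d j <= t)%N) /=.
rewrite [X in _ - (_ + X)]big1 ?addr0; last first.
  by move=> j; rewrite -ltnNge => dj; apply: pihomogM_small dj.
rewrite (eq_bigr (fun j => pihomog (t - d j) (c j) * F j)); last first.
  by move=> j dj; rewrite -{1}(subnK dj) (pihomogM _ _ (F_homog j)).
set S := \sum_(j | _) _ => If'.
have IS : I (S - \sum_(j | (d j <= t)%N) a j *: (L ^+ (t - d j) * F j)).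
  by rewrite -sumrB; apply: ideal_sum => // j _; rewrite scalerAl -mulrBl.
by have := idealD I_ideal If' IS; rewrite addrA subrK.
Qed.

(** Among the terms with nonzero coefficient take one of largest degree, [d j0]. The relation is
    then divisible by [L ^+ (t - d j0)]; cancelling this power leaves [F j0] with a constant nonzero
    coefficient, against minimality. *)
Lemma separators_indep t (a : 'I_nu -> k) :
  I (\sum_(j | (d j <= t)%N) a j *: (L ^+ (t - d j) * F j)) ->
  forall j, (d j <= t)%N -> a j = 0.
Proof.
move=> Ia j1 dj1; apply/eqP/negPn/negP => aj1.
have : (d j1 <= t)%N && (a j1 != 0) by apply/andP.
case/(arg_maxnP d (P := fun j => (d j <= t)%N && (a j != 0))) => j0.
move=> /andP[dj0 aj0] maxj0.
(* Dropping the terms of degree above [d j0] changes nothing: within the relation their coefficients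
   vanish by the choice of [j0]. *)
pose c j : R := if (d j <= d j0)%N then a j *: L ^+ (d j0 - d j) else 0.
have Ic : I (\sum_j c j * F j).
  apply: (@Lexp_sat (t - d j0)); rewrite mulr_sumr.
  rewrite (bigID (fun j => d j <= t)%N) /= [X in _ + X]big1 ?addr0; last first.
    move=> j; rewrite -ltnNge /c => dj; case: leqP => [jj|_].
      by have := leq_ltn_trans (leq_trans jj dj0) dj; rewrite ltnn.
    by rewrite mul0r mulr0.
  move: Ia; congr I; apply: eq_bigr => j dj; rewrite /c; case: leqP => jj.
    by rewrite -scalerAl -scalerAr mulrA -exprD addnBA // subnK.
  rewrite mul0r mulr0; have -> : a j = 0; last by rewrite scale0r.
  apply/eqP/negPn/negP => aj; move: (maxj0 j); rewrite dj aj.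
  by move=> /(_ isT) /(leq_trans jj); rewrite ltnn.
have cj0 : c j0 = (a j0)%:MP by rewrite /c leqnn subnn expr0 alg_mpolyC.
have uc : (a j0)^-1%:MP * c j0 = 1 by rewrite cj0 -mpolyCM mulVf // mpolyC1.
have [r [G [rnu genG]]] := drop_generator I_ideal I'_ideal I_sub F_I' F_gen Ic uc.
exact: F_min genG.
Qed.

(** The component [g'] of [g] in degree [t - 1] satisfies [L * g'] in [I'], so it lies in [I'] and
    is spanned by separators of smaller degree. Substituting this gives a relation to which
    [separators_indep] applies. *)
Lemma separators_indep_mod t (a : 'I_nu -> k) g :
  I (\sum_(j | d j == t) a j *: F j - L * g) -> forall j, d j = t -> a j = 0.
Proof.
set x := (X in X - _) => Ixg.
have hx : x \is t.-homog.
  by apply: rpred_sum => j /eqP dj; apply: rpredZ; rewrite -dj.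
have xI' : I' x by apply: ideal_sum => // j _; apply: idealZ.
have Ixt := I_homog t Ixg; rewrite linearB /= pihomog_dE // in Ixt.
(* In degree 0 the product with [L] has no component, so the relation is already one among the
   separators. *)
clear Ixg; case: t @x hx xI' Ixt => [|u] x hx xI' Ixt.
  rewrite mulrC (pihomogM_small _ L_homog) // subr0 in Ixt.
  move=> j dj; apply: (@separators_indep 0) => //; last by rewrite dj.
  move: Ixt; congr I; apply: eq_big => [i|i /eqP di]; first by rewrite leqn0.
  by rewrite di expr0 mul1r.
rewrite -(addn1 u) mulrC (pihomogM _ _ L_homog) in Ixt.
set g' := pihomog u g in Ixt.
have I'g' : I' g'.
  apply: L_sat'; rewrite mulrC -[g' * L](subKr x).
  by apply: idealB => //; apply: I_sub.
have [b Ib] := separators_span (pihomogP _ _ _) I'g'.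
(* The coefficients of the combined relation: those of [x] in degree [u.+1], and below it those of
   [- L * g'], where [L] raises each exponent by one. *)
pose e j := if d j == u.+1 then a j else - b j.
move=> j dj; have <- : e j = a j by rewrite /e dj eqxx.
apply: (@separators_indep u.+1); last by rewrite dj.
have := idealD I_ideal Ixt (ideal_mull I_ideal L Ib); congr I.
rewrite [RHS](bigID (fun j => d j == u.+1)) /= mulrBr (mulrC L) addrA subrK.
congr (_ + _).
  apply: eq_big => [i|i /eqP di]; first by case: eqP => [->|]; rewrite ?leqnn ?andbF.
  by rewrite /e di eqxx subnn expr0 mul1r.
rewrite mulr_sumr -sumrN; apply: eq_big => [i|i di].
  by rewrite andbC -ltn_neqAle.
rewrite /e ltn_eqF ?ltnS // scaleNr -scalerAr mulrA -exprS subSn //.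
Qed.

(** The products [L ^+ (t - d j) * F j] with [d j <= t] complete a basis of the degree [t] part of
    [I] to one of [I']. *)
Lemma hilbert_separators t :
  hilbert I t = (hilbert I' t + #|[set j | (d j <= t)%N]|)%N.
Proof.
have [U UI] := graded_piece I_ideal t; have [U' UI'] := graded_piece I'_ideal t.
have := hilbert_dim UI; rewrite -(hilbert_dim UI').
set J := [set j | _].
(* The subtraction is truncated, so [w j] is used only for [d j <= t]. *)
pose w j : dhomog n.+1 k t := indhomog t (L ^+ (t - d j) * F j).
have wE j : (d j <= t)%N -> mpoly_of_dhomog (w j) = L ^+ (t - d j) * F j.
  move=> dj; rewrite /w /indhomog /= insubdK // -[t in _ \is t.-homog](subnK dj).
  by apply: dhomogM => //; have := dhomogMn (t - d j) L_homog; rewrite mul1n.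
pose X := [tuple w (enum_val i) | i < #|J|].
have -> : \dim U' = (#|J| + \dim U)%N.
  rewrite -(@dim_span_add _ _ U _ X); last first.
    move=> c /UI cU i; have [a ac] := extend_enum_val c.
    rewrite -ac; apply: (@separators_indep t); last by have := enum_valP i; rewrite inE.
    move: cU; congr I; rewrite linear_sum /=.
    under eq_bigr do rewrite tnth_mktuple -ac.
    transitivity (\sum_(j in J) a j *: mpoly_of_dhomog (w j)).
      by rewrite [RHS]big_enum_val.
    by apply: eq_big => [j|j]; rewrite inE // => dj; rewrite wE.
  apply/eqP; rewrite eqn_leq; apply/andP; split; apply/dimvS/subvP => v.
    move=> /UI' I'v; have [a Ia] := separators_span (dhomog_is_dhomog v) I'v.
    have Xv : \sum_(j in J) a j *: w j \in <<X>>%VS.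
      apply: rpred_sum => j jJ; apply: rpredZ; apply: memv_span.
      by apply/mapP; exists (enum_rank_in jJ j); rewrite ?mem_enum // enum_rankK_in.
    rewrite -[v](addrNK (\sum_(j in J) a j *: w j)) addrC.
    apply: memv_add => //; apply/UI; rewrite linearB linear_sum /=.
    move: Ia; congr (I (_ - _)); apply: eq_big => [j|j dj]; first by rewrite inE.
    by rewrite wE.
  move=> /memv_addP[x Xx [y /UI yU ->]]; apply: rpredD; last exact/UI'/I_sub.
  move: x Xx; apply/subvP/span_subvP => x /mapP[i _ ->]; apply/UI'.
  by rewrite wE; [apply: ideal_mull|have := enum_valP i; rewrite inE].
by rewrite addnA => /addIn.
Qed.

Lemma first_difference_separators t :
  first_difference (hilbert I') t =
  first_difference (hilbert I) t - (#|[set j | d j == t]|)%:Z.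
Proof.
rewrite /first_difference !hilbert_separators PoszD.
case: t => [|t].
  have -> : [set j | (d j <= 0)%N] = [set j | d j == 0%N].
    by apply/setP => j; rewrite !inE leqn0.
  by rewrite !subr0 addrK.
rewrite hilbert_separators PoszD.
have -> : #|[set j | (d j <= t.+1)%N]| =
    (#|[set j | (d j <= t)%N]| + #|[set j | d j == t.+1]|)%N.
  rewrite -cardsUI [X in (_ + X)%N](_ : _ = 0%N) ?addn0.
    by congr #|pred_of_set _|; apply/setP => j; rewrite !inE leq_eqVlt orbC.
  apply/eqP; rewrite cards_eq0; apply/eqP/setP => j; rewrite !inE.
  by case: eqP => [->|]; rewrite ?ltnn ?andbF.
by rewrite PoszD; ring.
Qed.

End SeparatorModule.

(** * Lifting along a resolution modulo a regular sequence *)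

Section RegularSequence.
Variables (A : comNzRingType) (n : nat) (a : nat -> A -> Prop) (y : nat -> A).
Hypothesis a_ideal : forall p, is_ideal (a p).
Hypothesis a_zero : forall f, a 0%N f <-> exists u, f = y 0%N * u.
Hypothesis a_succ : forall p f, (p < n)%N ->
  a p.+1 f <-> exists u, a p (f - y p.+1 * u).
Hypothesis y_zero_reg : forall f, y 0%N * f = 0 -> f = 0.
Hypothesis y_reg : forall p f, (p < n)%N -> a p (y p.+1 * f) -> a p f.

Definition row_in p N (v : 'rV[A]_N) : Prop := forall j, a p (v 0 j).

Section RowIn.
Variables (p N : nat).
Implicit Types v w : 'rV[A]_N.

Lemma row_in0 : row_in p (0 : 'rV[A]_N).
Proof. by move=> j; rewrite mxE; apply: ideal0. Qed.

Lemma row_inD v w : row_in p v -> row_in p w -> row_in p (v + w).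
Proof. by move=> hv hw j; rewrite mxE; apply: idealD. Qed.

Lemma row_inZ c v : row_in p v -> row_in p (c *: v).
Proof. by move=> hv j; rewrite mxE; apply: ideal_mull. Qed.

Lemma row_inB v w : row_in p v -> row_in p w -> row_in p (v - w).
Proof. by move=> hv hw; rewrite -scaleN1r; apply/row_inD/row_inZ. Qed.

Lemma row_inM v M (B : 'M[A]_(N, M)) : row_in p v -> row_in p (v *m B).
Proof.
move=> hv j; rewrite mxE; apply: (ideal_sum (a_ideal p)) => l _.
exact: (ideal_mulr (a_ideal p) _ (hv l)).
Qed.

Lemma row_in_reg v : (p < n)%N -> row_in p (y p.+1 *: v) -> row_in p v.
Proof. by move=> pn hv j; apply: y_reg => //; have := hv j; rewrite mxE. Qed.

Lemma row_in_succ v : (p < n)%N ->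
  row_in p.+1 v <-> exists u, row_in p (v - y p.+1 *: u).
Proof.
move=> pn; split=> [hv|[u hu] j]; last first.
  by apply/a_succ => //; exists (u 0 j); have := hu j; rewrite !mxE.
have /fin_all_exists[u hu] j : exists u, a p (v 0 j - y p.+1 * u).
  exact/a_succ.
by exists (\row_j u j) => j; rewrite !mxE.
Qed.

Lemma row_in_zero v : row_in 0 v <-> exists u, v = y 0%N *: u.
Proof.
split=> [hv|[u ->] j]; last by rewrite mxE; apply/a_zero; exists (u 0 j).
have /fin_all_exists[u hu] j : exists u, v 0 j = y 0%N * u by exact/a_zero.
by exists (\row_j u j); apply/rowP => j; rewrite !mxE.
Qed.

End RowIn.

Variables (N : nat -> nat) (D : forall p, 'M[A]_(N p.+1, N p)).
Hypothesis D_exact : forall p (v : 'rV_(N p.+1)),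
  v *m D p = 0 <-> exists w, v = w *m D p.+1.
(** In place of exactness in position 0: [y 0] is regular on the cokernel of [D 0]. *)
Hypothesis D_sat : forall (u : 'rV_(N 0%N)) (w : 'rV_(N 1%N)),
  y 0%N *: u = w *m D 0%N -> exists w' : 'rV_(N 1%N), u = w' *m D 0%N.

Lemma D_comp p (w : 'rV_(N p.+2)) : w *m D p.+1 *m D p = 0.
Proof. by apply/D_exact; exists w. Qed.

(* As in a mapping cone, killing one more element of the sequence destroys
   exactness in one more place only. *)
Lemma exact_mod p q (v : 'rV_(N q.+1)) : (p <= n)%N -> (p <= q)%N ->
  row_in p (v *m D q) -> exists w, row_in p (v - w *m D q.+1).
Proof.
elim: p q v => [|p IH] q v pn pq.
  move=> /row_in_zero[u vu].
  (* Then [v - y 0 *: w] is an honest cycle. Such a [w] comes from [D_sat] in the lowest position,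
     and from exactness together with regularity of [y 0] in the others. *)
  suff [w uw] : exists w, u = w *m D q.
    have /D_exact[w' hw'] : (v - y 0%N *: w) *m D q = 0.
      by rewrite mulmxBl vu -scalemxAl -uw subrr.
    by exists w'; rewrite -hw' subKr; apply/row_in_zero; exists w.
  case: q v u vu {pq} => [|q] v u vu; first exact: D_sat (esym vu).
  apply/D_exact; apply/rowP => j; rewrite [RHS]mxE; apply: y_zero_reg.
  have /rowP/(_ j) : y 0%N *: u *m D q = 0 by rewrite -vu D_comp.
  by rewrite -scalemxAl !mxE.
case: q v pq => // q v pq /row_in_succ-/(_ pn)[u hu].
have pn' := ltnW pn.
(* The cofactor [u] is a cycle modulo [a p] one position lower; this use of induction is what costs
   one position of exactness. *)
have /(IH _ _ pn' pq)[w hw] : row_in p (u *m D q).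
  apply: row_in_reg => //; have := row_inM (D q) hu.
  rewrite mulmxBl D_comp sub0r -scalemxAl -scaleN1r => /(row_inZ (-1)).
  by rewrite scalerA mulrNN mulr1 scale1r.
have [|w' hw'] := IH q.+1 (v - y p.+1 *: w) pn' (leqW pq).
  have -> : (v - y p.+1 *: w) *m D q.+1 =
      (v *m D q.+1 - y p.+1 *: u) + y p.+1 *: (u - w *m D q.+1).
    by rewrite mulmxBl -scalemxAl scalerBr addrA subrK.
  by apply: row_inD => //; apply: row_inZ.
by exists w'; apply/row_in_succ => //; exists w; rewrite addrAC.
Qed.

Definition lift_step p (x : 'rV_(N p)) (z : 'rV_(N p.+1)) : Prop :=
  row_in p (y p.+1 *: x - z *m D p).

(** The invariant that lets the lifting continue: modulo [a p], every remaining [y l] carries [x]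
    into the image of [D p]. *)
Definition liftable p (x : 'rV_(N p)) : Prop := forall l, (p < l <= n)%N ->
  exists z : 'rV_(N p.+1), row_in p (y l *: x - z *m D p).

(** If [b] solves the equation of [x] for [y l], then [y l *: z - y p.+1 *: b] is a cycle modulo
    [a p], hence a boundary there by [exact_mod]; modulo [a p.+1] the term in [b] disappears. *)
Lemma lift_step_liftable p x z : (p < n)%N ->
  liftable x -> @lift_step p x z -> liftable z.
Proof.
move=> pn hx xz l /andP[pl ln].
have [|b hb] := hx l; first by rewrite (ltnW pl).
have [|w hw] := @exact_mod p p (y l *: z - y p.+1 *: b) (ltnW pn) (leqnn p).
  have -> : (y l *: z - y p.+1 *: b) *m D p =
      y p.+1 *: (y l *: x - b *m D p) - y l *: (y p.+1 *: x - z *m D p).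
    rewrite mulmxBl -!scalemxAl !scalerBr !scalerA (mulrC (y l)).
    by rewrite opprB [RHS]addrC addrA addrNK.
  by apply: row_inB; apply: row_inZ.
by exists w; apply/row_in_succ => //; exists b; rewrite addrAC.
Qed.

(** Write [z] as [u *m D p.+1 + y p.+1 *: u'] modulo [a p] and apply [D p]: the boundary vanishes
    and [y p.+1] can be cancelled. *)
Lemma lift_step_inj p x z u : (p < n)%N -> @lift_step p x z ->
  row_in p.+1 (z - u *m D p.+1) -> exists u', row_in p (x - u' *m D p).
Proof.
move=> pn xz /row_in_succ-/(_ pn)[u' hu']; exists u'; apply: row_in_reg => //.
have -> : y p.+1 *: (x - u' *m D p) = (y p.+1 *: x - z *m D p) +
    (z - u *m D p.+1 - y p.+1 *: u') *m D p.
  by rewrite !mulmxBl D_comp subr0 -scalemxAl scalerBr addrA subrK.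
by apply: row_inD => //; apply: row_inM.
Qed.

Fixpoint lift_chain p (x : 'rV_(N 0%N)) : 'rV_(N p) -> Prop :=
  if p is q.+1 then fun z => exists2 w, lift_chain x w & @lift_step q w z
  else fun z => z = x.

Lemma lift_chain_sum (J : Type) (r : seq J) (Q : pred J) p (c : J -> A) x z :
  (forall j, Q j -> @lift_chain p (x j) (z j)) ->
  lift_chain (\sum_(j <- r | Q j) c j *: x j) (\sum_(j <- r | Q j) c j *: z j).
Proof.
elim: p z => [|p IH] z /= xz; first by apply: eq_bigr => j /xz ->.
(* Intermediate elements are chosen for all indices at once, with 0 as a dummy outside [Q]. *)
have /choice[w hw] : forall j, exists w, Q j -> lift_chain (x j) w /\ lift_step w (z j).
  move=> j; case: (boolP (Q j)) => Qj; last by exists 0.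
  by have [w] := xz j Qj; exists w.
exists (\sum_(j <- r | Q j) c j *: w j); first by apply: IH => j /hw[].
rewrite /lift_step scaler_sumr mulmx_suml -sumrB.
elim/big_ind: _ => [|v v'|j /hw[_ wz]]; [exact: row_in0|exact: row_inD|].
by rewrite -scalemxAl scalerA mulrC -scalerA -scalerBr; apply: row_inZ.
Qed.

Lemma lift_chain_inj p x z u : (p <= n)%N -> @lift_chain p x z ->
  row_in p (z - u *m D p) -> exists u', row_in 0 (x - u' *m D 0%N).
Proof.
elim: p z u => [|p IH] z u pn /=; first by move=> ->; exists u.
move=> [w xw wz] /(lift_step_inj pn wz)[u' hu'].
exact: IH (ltnW pn) xw hu'.
Qed.

End RegularSequence.

(** * The regular sequence of a coordinate system *)

Section CoordinateSequence.
Variables (k : fieldType) (n : nat).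
Local Notation R := {mpoly k[n.+1]}.

(** The monomials outside [Q] are divisible by the variable; [u] collects their quotients. *)
Lemma supp_in_split (Q : pred 'X_{1..n.+1}) (i : 'I_n.+1) (f : R) :
  supp_in (fun e => Q e || (e i != 0%N)) f -> exists u, supp_in Q (f - 'X_i * u).
Proof.
move=> hf; exists (\sum_(e <- msupp f | ~~ Q e) f@_e *: 'X_[e - U_(i)]).
rewrite {1}[f]mpolyE (bigID Q) /= mulr_sumr -addrA -sumrB.
rewrite [X in _ + X]big_seq_cond [X in _ + X]big1 ?addr0 => [|e /andP[ef Qe]].
  elim/big_rec: _ => [|e g Qe Qg]; first exact: supp_in0.
  apply: supp_inD => //; apply: supp_inZ => e'.
  by move/mem_msuppXP <-.
have := hf e ef; rewrite (negPf Qe) /= => ei.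
rewrite -scalerAr -mpolyXD addmC submK ?subrr //.
by apply/mnm_lepP => j; rewrite mnm1E; case: eqP => // <-; rewrite lt0n.
Qed.

Lemma mcoeff0_homog d (f : R) : f \is d.-homog -> d != 0%N -> f@_0 = 0.
Proof. by move=> hf d0; apply: (dhomog_nemf_coeff hf); rewrite /= mdeg0 eq_sym. Qed.

Variable A : 'M[k]_n.+1.
Hypothesis uA : A \in unitmx.

(** The inverse matrix makes this form become a variable after [lin_subst A]. The index is a natural
    number, as in the abstract regular sequence; only [p <= n] is meaningful. *)
Definition coord_form (p : nat) : R := lin_subst (invmx A) 'X_(inord p).

Definition involves (p : nat) (e : 'X_{1..n.+1}) :=
  [exists l : 'I_n.+1, (l <= p)%N && (e l != 0%N)].

(* The ideal generated by [coord_form 0], ..., [coord_form p], read off the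
   monomials after the change of coordinates. *)
Definition coord_ideal (p : nat) (f : R) : Prop := supp_in (involves p) (lin_subst A f).

Lemma coord_substK p : lin_subst A (coord_form p) = 'X_(inord p).
Proof. by rewrite lin_substKV. Qed.

Lemma coord_homog p : coord_form p \is 1.-homog.
Proof. by apply: lin_subst_homog; rewrite dhomogX; apply/eqP/mdeg1. Qed.

Lemma supp_in_involves p : is_ideal (supp_in (involves p) : R -> Prop).
Proof.
apply: supp_in_ideal => a b /existsP[l /andP[lp bl]]; apply/existsP; exists l.
by rewrite lp mnmDE addn_eq0 negb_and bl orbT.
Qed.

Lemma coord_ideal_ideal p : is_ideal (coord_ideal p).
Proof.
have [h0 hD hM] := supp_in_involves p.
split; rewrite /coord_ideal => *; rewrite ?rmorph0 ?rmorphD ?rmorphM //=.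
  exact: hD.
exact: hM.
Qed.

Lemma coord_ideal_pihomog p t f : coord_ideal p f -> coord_ideal p (pihomog t f).
Proof. by rewrite /coord_ideal lin_subst_pihomog; apply: supp_in_pihomog. Qed.

Lemma coord_ideal_zero f : coord_ideal 0 f <-> exists u, f = coord_form 0 * u.
Proof.
split=> [hf|[u ->]].
  (* With [pred0] the remainder has empty support, so divisibility is exact. *)
  have [|u hu] := @supp_in_split pred0 (inord 0) (lin_subst A f).
    move=> e /hf /existsP[l /andP[]]; rewrite leqn0 => /eqP l0 /=.
    by have -> : inord 0 = l by apply/val_inj; rewrite /= inordK.
  exists (lin_subst (invmx A) u); rewrite -rmorphM -[f](lin_substK uA); congr lin_subst.
  apply/eqP; rewrite -subr_eq0; apply/negPn/negP => nz.
  by have := hu _ (mlead_supp nz).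
apply: (ideal_mulr (coord_ideal_ideal 0)); rewrite /coord_ideal coord_substK.
move=> e /mem_msuppXP <-; apply/existsP; exists (inord 0).
by rewrite inordK // mnm1E eqxx.
Qed.

Lemma coord_ideal_succ p f : (p < n)%N ->
  coord_ideal p.+1 f <-> exists u, coord_ideal p (f - coord_form p.+1 * u).
Proof.
move=> pn; split=> [hf|[u hu]].
  have [|u hu] := @supp_in_split (involves p) (inord p.+1) (lin_subst A f).
    move=> e /hf /existsP[l /andP[]]; rewrite leq_eqVlt => /orP[/eqP lp|lp] el.
      have <- : l = inord p.+1 by apply/val_inj; rewrite /= inordK.
      by rewrite el orbT.
    by apply/orP; left; apply/existsP; exists l; rewrite -ltnS lp el.
  exists (lin_subst (invmx A) u).
  by rewrite /coord_ideal rmorphB rmorphM /= coord_substK lin_substKV.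
rewrite -[f](subrK (coord_form p.+1 * u)); apply: (idealD (coord_ideal_ideal _)).
  move=> e /hu /existsP[l /andP[lp el]].
  by apply/existsP; exists l; rewrite el leqW.
apply: (ideal_mulr (coord_ideal_ideal _)); rewrite /coord_ideal coord_substK.
move=> e /mem_msuppXP <-; apply/existsP; exists (inord p.+1).
by rewrite inordK // mnm1E eqxx leqnn.
Qed.

Lemma coord_zero_reg f : coord_form 0 * f = 0 -> f = 0.
Proof.
move/eqP; rewrite mulf_eq0 => /orP[/eqP c0|/eqP //].
have := coord_substK 0; rewrite c0 rmorph0 => /esym/eqP.
by rewrite -msupp_eq0 msuppX.
Qed.

(** Multiplying a monomial by the variable of index [p.+1] does not affect which of the variables up
    to [p] occur in it. *)
Lemma coord_reg p f : (p < n)%N -> coord_ideal p (coord_form p.+1 * f) -> coord_ideal p f.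
Proof.
move=> pn; rewrite /coord_ideal rmorphM /= coord_substK.
move=> /supp_inXM hf e /hf /existsP[l /andP[lp el]].
apply/existsP; exists l; rewrite lp; move: el; rewrite mnmDE mnm1E.
case: (eqVneq (inord p.+1) l) => [pl|_]; last by rewrite add0n.
by move: lp; rewrite -pl inordK // ltnn.
Qed.

(** A linear substitution preserves the constant term, and every other monomial involves one of the
    [n.+1] variables. *)
Lemma coord_ideal_top f : f@_0 = 0 -> coord_ideal n f.
Proof.
move=> f0 e ef; have e0 : e != 0%MM.
  apply: contraTneq ef => ->; rewrite mcoeff_msupp negbK.
  have -> : (lin_subst A f)@_0 = (pihomog 0 (lin_subst A f))@_0.
    by rewrite mcoeff_pihomog mdeg0.
  rewrite -lin_subst_pihomog; have -> : pihomog 0 f = 0; last by rewrite rmorph0 mcoeff0.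
  apply/mpolyP => e'; rewrite mcoeff_pihomog mcoeff0 mdeg_eq0.
  by case: eqP => [->|].
apply: contraR e0; rewrite negb_exists => /forallP h; apply/eqP/mnmP => l.
by rewrite mnm0E; have := h l; rewrite -ltnS ltn_ord /= negbK => /eqP.
Qed.

End CoordinateSequence.

(** * Integer gradings *)

Section Grading.
Variables (k : fieldType) (n : nat).
Local Notation R := {mpoly k[n.+1]}.

(** Shifts are integers, so components are also taken in negative degrees, where 0 is the only
    form. *)
Definition zpihomog (e : int) (f : R) : R := if e is Posz t then pihomog t f else 0.

Lemma zpihomogP e f : form_of_degree e (zpihomog e f).
Proof. by case: e => //= t; apply: pihomogP. Qed.

Lemma zpihomog_id e f : form_of_degree e f -> zpihomog e f = f.
Proof. by case: e => [t /pihomog_dE|t ->]. Qed.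

Lemma form_of_degree0 e : form_of_degree e (0 : R).
Proof. by case: e => //= t; apply: rpred0. Qed.

Lemma form_of_degree_const e (f : R) : e != 0 -> form_of_degree e f -> f@_0 = 0.
Proof.
by case: e => [t t0 hf|t _ ->]; [apply: mcoeff0_homog hf t0|rewrite mcoeff0].
Qed.

Lemma form_of_degreeM c e (f g : R) : f \is c.-homog -> form_of_degree e g ->
  form_of_degree (e + c) (f * g).
Proof.
case: e => e hf hg; last by rewrite hg mulr0; apply: form_of_degree0.
by rewrite mulrC; apply: dhomogM.
Qed.

Lemma zpihomogM e c f g : form_of_degree c g ->
  zpihomog (e + c) (f * g) = zpihomog e f * g.
Proof.
case: c => [c|c] /= hg; last first.
  by rewrite hg !mulr0; case: (e + _) => //= t; rewrite pihomog0.
case: e => [e|e] /=; first exact: pihomogM.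
(* For negative [e] the total degree is below that of [g], so the product has no such component. *)
rewrite mul0r; case E: (Negz e + c) => [t|t] //=.
by apply: pihomogM_small hg _; move: E; rewrite NegzE; lia.
Qed.

Lemma zpihomogB e : {morph zpihomog e : f g / f - g}.
Proof. by case: e => [t|t] f g /=; rewrite ?linearB ?subr0. Qed.

Lemma zpihomog_sum e (J : Type) (r : seq J) (Q : pred J) (G : J -> R) :
  zpihomog e (\sum_(j <- r | Q j) G j) = \sum_(j <- r | Q j) zpihomog e (G j).
Proof.
case: e => [t|t] /=; first exact: (linear_sum (pihomog t)).
by rewrite big1.
Qed.

Definition row_homog N (b : 'I_N -> int) (e : int) (v : 'rV[R]_N) : Prop :=
  forall j, form_of_degree (e - b j) (v 0 j).

Definition row_component N (b : 'I_N -> int) (e : int) (v : 'rV[R]_N) : 'rV[R]_N :=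
  \row_j zpihomog (e - b j) (v 0 j).

Lemma row_componentP N (b : 'I_N -> int) e v : row_homog b e (row_component b e v).
Proof. by move=> j; rewrite mxE; apply: zpihomogP. Qed.

Lemma row_componentM M N (b : 'I_M -> int) (b' : 'I_N -> int) e v (B : 'M[R]_(M, N)) :
  (forall i j, form_of_degree (b i - b' j) (B i j)) ->
  row_component b' e (v *m B) = row_component b e v *m B.
Proof.
move=> hB; apply/rowP => j; rewrite !mxE zpihomog_sum; apply: eq_bigr => i _.
have -> : e - b' j = (e - b i) + (b i - b' j) by rewrite addrA subrK.
by rewrite zpihomogM // mxE.
Qed.

End Grading.

(** * The last module of a resolution *)

Section Resolution.
Variables (k : fieldType) (n : nat).
Local Notation R := {mpoly k[n.+1]}.
Variables (A : 'M[k]_n.+1) (I : R -> Prop).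
Hypothesis uA : A \in unitmx.
Hypothesis I_sat : forall f, I (coord_form A 0 * f) -> I f.
Variables (F : nat -> seq int)
  (d : forall i, {linear gfree k n (F i.+1) -> gfree k n (F i)})
  (eps : {linear gfree k n (F 0%N) -> {mpoly k[n.+1]}^o}).
Hypothesis res : minimal_resolution I n d eps.

(* The resolution of the quotient by [I]: the free module of rank one sits in
   position 0 and [F p] in position [p.+1]. *)
Definition res_rank (p : nat) : nat := if p is q.+1 then size (F q) else 1%N.

Definition res_shift (p : nat) : 'I_(res_rank p) -> int :=
  match p with q.+1 => fun j => (F q)`_j | 0%N => fun=> 0 end.

Definition res_diff (p : nat) : 'M[R]_(res_rank p.+1, res_rank p) :=
  match p with
  | q.+1 => lin1_mx (d q)
  | 0%N => \matrix_(i, j) (eps (delta_mx 0 i) : R)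
  end.

Lemma res_diff0E v : v *m res_diff 0 = \row_j (eps v : R).
Proof.
apply/rowP => j; rewrite !mxE [in RHS](row_sum_delta v) linear_sum.
by apply: eq_bigr => i _; rewrite mxE linearZ.
Qed.

Lemma res_diff_exact p (v : 'rV_(res_rank p.+1)) :
  v *m res_diff p = 0 <-> exists w, v = w *m res_diff p.+1.
Proof.
case: p v => [|p] v /=.
  rewrite (res_diff0E v); split=> [/rowP/(_ 0)|[w ->]].
    by rewrite !mxE => /(exact_at_0 res)[w <-]; exists w; rewrite mul_rV_lin1.
  rewrite mul_rV_lin1; apply/rowP => j; rewrite !mxE.
  by apply/(exact_at_0 res); exists w.
rewrite mul_rV_lin1; split=> [/(exact_at_succ res)[w <-]|[w ->]].
  by exists w; rewrite mul_rV_lin1.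
by rewrite mul_rV_lin1; apply/(exact_at_succ res); exists w.
Qed.

Lemma res_diff_image f : I f <-> exists w, (const_mx f : 'rV[R]_1) = w *m res_diff 0.
Proof.
rewrite (augmentation_image res); split=> [[v <-]|[v]].
  by exists v; rewrite res_diff0E; apply/rowP => j; rewrite !mxE.
by rewrite res_diff0E => /rowP/(_ 0); rewrite !mxE => ->; exists v.
Qed.

(** The cokernel of [res_diff 0] is the quotient of the ring by [I], so regularity of the first
    coordinate form on it is [I_sat]. *)
Lemma res_diff_sat (u : 'rV_(res_rank 0)) (w : 'rV_(res_rank 1)) :
  coord_form A 0 *: u = w *m res_diff 0 ->
  exists w' : 'rV_(res_rank 1), u = w' *m res_diff 0.
Proof.
have E (x : 'rV[R]_1) : x = const_mx (x 0 0) by apply/rowP => j; rewrite mxE ord1.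
rewrite (E u) => uw; apply/res_diff_image/I_sat/res_diff_image.
by exists w; rewrite -uw; apply/rowP => j; rewrite !mxE.
Qed.

Lemma gfree_homog_delta (b : seq int) (i : 'I_(size b)) :
  gfree_homog b`_i (delta_mx 0 i : gfree k n b).
Proof.
move=> j; rewrite mxE eqxx /=; have [->|_] := eqVneq j i.
  by rewrite subrr /= dhomog1.
exact: form_of_degree0.
Qed.

Lemma res_diff_homog p i j :
  form_of_degree (res_shift i - res_shift j) (res_diff p i j).
Proof.
case: p i j => [|p] i j /=.
  by rewrite mxE subr0; apply: (augmentation_hom res); apply: gfree_homog_delta.
by rewrite mxE; apply: (resolution_hom res); apply: gfree_homog_delta.
Qed.

Let step p := @lift_step _ (coord_ideal A) (coord_form A) res_rank res_diff p.
Let chain p := @lift_chain _ (coord_ideal A) (coord_form A) res_rank res_diff p.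
Let liftable p := @liftable _ n (coord_ideal A) (coord_form A) res_rank res_diff p.

(** Any solution of a lifting equation can be replaced by its component of the expected degree,
    because the differentials, the coordinate forms and the coordinate ideals are homogeneous. *)
Lemma homog_lift_chain f e p : f \is e.-homog ->
  (forall l, (0 < l <= n)%N -> I (coord_form A l * f)) -> (p <= n)%N ->
  exists z : 'rV_(res_rank p), chain (const_mx f) z /\
    row_homog (@res_shift p) (e + p)%N z.
Proof.
(* The induction also carries [liftable], which provides the next equation with a solution. *)
move=> hf If pn; suff [z [? ? _]] : exists z : 'rV_(res_rank p),
    [/\ chain (const_mx f) z, row_homog (@res_shift p) (e + p)%N z & liftable z].
  by exists z.
elim: p pn => [|p IH] pn.
  exists (const_mx f); split=> //; first by move=> j; rewrite mxE subr0 addn0.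
  move=> l ln; have /res_diff_image[w hw] := If l ln.
  exists w; rewrite -hw => j; rewrite !mxE subrr; apply: ideal0.
  exact: coord_ideal_ideal.
have [z [fz hz lz]] := IH (ltnW pn).
have [|w hw] := lz p.+1; first by rewrite ltnSn.
pose w' := row_component (@res_shift p.+1) (e + p.+1)%N w.
have zw' : step z w'.
  rewrite /step /lift_step -(row_componentM _ _ (@res_diff_homog p)).
  move=> j; set t := (e + p.+1)%N%:Z - res_shift j.
  have Ez : coord_form A p.+1 * z 0 j = zpihomog t (coord_form A p.+1 * z 0 j).
    have -> : t = ((e + p)%N%:Z - res_shift j) + 1 by rewrite /t; lia.
    by rewrite zpihomog_id //; apply: form_of_degreeM (hz j); apply: coord_homog.
  have := hw j; rewrite !mxE -/t => hwj; rewrite Ez -zpihomogB.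
  case: t {Ez} => t /=; first exact: coord_ideal_pihomog.
  by apply: ideal0; apply: coord_ideal_ideal.
exists w'; split; [by exists z|exact: row_componentP|].
apply: (lift_step_liftable (a := coord_ideal A) (y := coord_form A)) pn lz zw'.
- exact: coord_ideal_ideal.
- exact: coord_ideal_zero.
- exact: coord_ideal_succ.
- exact: coord_zero_reg.
- exact: coord_reg.
- exact: res_diff_exact.
- exact: res_diff_sat.
Qed.

(** Entries without constant term lie in the top coordinate ideal, so descending the chain from the
    zero boundary puts [f] into [I] plus the multiples of the first coordinate form. *)
Lemma lift_chain_const f z : chain (const_mx f) z ->
  (forall j : 'I_(res_rank n), (z 0 j)@_0 = 0) -> exists g, I (f - coord_form A 0 * g).
Proof.
move=> fz z0.
have [|u hu] := lift_chain_inj (coord_ideal_ideal A) (coord_ideal_succ uA)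
  (coord_reg uA) res_diff_exact (u := 0) (leqnn n) fz.
  by rewrite mul0mx subr0 => j; apply: coord_ideal_top.
have /(coord_ideal_zero uA)[g hg] := hu 0; exists g; apply/res_diff_image.
by exists u; apply/rowP => j; rewrite -hg !mxE ord1 subKr.
Qed.

Lemma last_module_shifts (J : finType) (e : nat) (f : J -> R) :
  (forall j, f j \is e.-homog) ->
  (forall j l, (0 < l <= n)%N -> I (coord_form A l * f j)) ->
  (forall (a : J -> k) g, I (\sum_j a j *: f j - coord_form A 0 * g) ->
    forall j, a j = 0) ->
  (#|J| <= #|[set i | @res_shift n i == (e + n)%N%:Z]|)%N.
Proof.
move=> hf If indep; set S := [set i | _].
have /fin_all_exists[z hz] j := homog_lift_chain (hf j) (If j) (leqnn n).
(* Constant terms of the lifts, at the basis elements of degree [e + n]. A row relation yields a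
   combination of lifts without constant terms, so its coefficients vanish by [lift_chain_const] and
   [indep]. *)
pose M : 'M[k]_(#|J|, #|S|) :=
  \matrix_(r, s) (z (enum_val r) 0 (enum_val s))@_0.
suff /eqP <- : row_free M by apply: rank_leq_col.
apply: inj_row_free => v vM; have [a av] := extend_enum_val (v 0).
apply/rowP => r; rewrite -av mxE.
have [||g] := @lift_chain_const (\sum_j a j *: f j) (\sum_j (a j)%:MP *: z j).
- have -> : (const_mx (\sum_j a j *: f j) : 'rV[R]_1) =
      \sum_j (a j)%:MP *: const_mx (f j).
    apply/rowP => i; rewrite mxE summxE; apply: eq_bigr => j _.
    by rewrite !mxE mul_mpolyC.
  by apply: (lift_chain_sum (coord_ideal_ideal A)) => j _; have [] := hz j.
- move=> i; rewrite summxE (linear_sum (mcoeff 0%MM)) /=.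
  under eq_bigr do rewrite mxE mul_mpolyC mcoeffZ.
  have [iS|iS] := boolP (i \in S).
    rewrite (reindex _ (onW_bij _ (enum_val_bij J))) /=.
    move/rowP/(_ (enum_rank_in iS i)): vM; rewrite !mxE => vM; rewrite -[RHS]vM.
    by apply: eq_bigr => q _; rewrite mxE av enum_rankK_in.
  (* Outside [S] the entry is a form of nonzero degree and has no constant term. *)
  rewrite big1 // => j _; have [_ /(_ i) hi] := hz j.
  rewrite (form_of_degree_const _ hi) ?mulr0 //.
  by rewrite subr_eq0 eq_sym; move: iS; rewrite inE.
by move=> /indep ->.
Qed.

End Resolution.

(** * Permuting the basis of a graded free module *)

Lemma count_tnth (T : Type) r (t : r.-tuple T) (p : pred T) :
  count p t = #|[set j | p (tnth t j)]|.
Proof.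
rewrite -{1}(map_tnth_enum t) count_map -sum1_count big_enum_cond /= -sum1_card.
by apply: eq_bigl => j; rewrite inE.
Qed.

Lemma colsub_gfree_iso (k : fieldType) (n : nat) (a b : seq int)
    (s : 'I_(size b) -> 'I_(size a)) :
  bijective s -> (forall j, a`_(s j) = b`_j) -> gfree_iso k n a b.
Proof.
move=> [s' sK s'K] ab; exists (mxsub id s); split.
  by move=> e v hv j; rewrite mxE -ab.
by exists (mxsub id s') => v; apply/rowP => j; rewrite !mxE ?sK ?s'K.
Qed.

Lemma perm_gfree_iso (k : fieldType) (n : nat) (a b : seq int) :
  perm_eq a b -> gfree_iso k n a b.
Proof.
rewrite perm_sym => ab; have eq_sz := perm_size ab.
have /tuple_permP[p bE] : perm_eq b (in_tuple a) by [].
apply: (@colsub_gfree_iso _ _ _ _ (fun j => p (cast_ord eq_sz j))).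
  apply: bij_comp; first by exists (p^-1)%g; [apply: permK|apply: permKV].
  by exists (cast_ord (esym eq_sz)); [apply: cast_ordK|apply: cast_ordKV].
move=> j; have jb : (j < size a)%N by rewrite -eq_sz.
rewrite (congr1 (fun u : seq int => u`_j) bE).
rewrite -(tnth_nth 0 [tuple tnth (in_tuple a) (p i)  | i < size a] (Ordinal jb)).
by rewrite tnth_mktuple (tnth_nth 0) /=; congr (_`_(p _)); apply: val_inj.
Qed.

Lemma count_leq_perm_cat (T : eqType) (s t : seq T) :
  (forall x, (count_mem x t <= count_mem x s)%N) -> exists u, perm_eq s (u ++ t).
Proof.
move=> /count_subseqP[t' /perm_to_subseq[u su] tt']; exists u.
by rewrite (perm_trans su) // perm_catC perm_cat2l perm_sym.
Qed.

(** * Fat points *)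

(** The forms with coefficients 1, t, t^2, ... suffice: the value at each point is a nonzero
    polynomial in [t], and some [t] avoids the roots of their product. Scaling normalizes the value
    at [P i]. *)
Lemma generic_linear_form (k : closedFieldType) (n s : nat)
    (P : 'I_s -> 'rV[k]_n.+1) (i : 'I_s) : (forall j, P j != 0) ->
  exists c : 'rV[k]_n.+1, [/\ c 0 0 != 0,
    forall j, \sum_l c 0 l * P j 0 l != 0 & \sum_l c 0 l * P i 0 l = 1].
Proof.
move=> P0; pose q j := \poly_(l < n.+1) P j 0 (inord l).
have q0 j : q j != 0.
  apply: contraNneq (P0 j) => qj0; apply/eqP/rowP => l; rewrite mxE.
  have : (q j)`_l = 0 by rewrite qj0 coef0.
  by rewrite coef_poly ltn_ord inord_val.
have /closed_nonrootP[t] : \prod_j q j != 0 by apply/prodf_neq0.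
rewrite /root horner_prod => /prodf_neq0 qt.
have qE j : (q j).[t] = \sum_(l < n.+1) t ^+ l * P j 0 l.
  by rewrite horner_poly; apply: eq_bigr => l _; rewrite inord_val mulrC.
pose c : 'rV[k]_n.+1 := \row_l ((q i).[t]^-1 * t ^+ l).
have cE j : \sum_l c 0 l * P j 0 l = (q i).[t]^-1 * (q j).[t].
  by rewrite (qE j) mulr_sumr; apply: eq_bigr => l _; rewrite mxE mulrA.
exists c; split=> [|j|]; first by rewrite mxE mulr1 invr_eq0 qt.
  by rewrite cE mulf_neq0 ?invr_eq0 ?qt.
by rewrite cE mulVf ?qt.
Qed.

Section FatPoints.
Variables (k : fieldType) (n s : nat) (P : 'I_s -> 'rV[k]_n.+1).
Variable c : 'rV[k]_n.+1.
Hypotheses (c0 : c 0 0 != 0) (cP : forall j, \sum_l c 0 l * P j 0 l != 0).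
Local Notation R := {mpoly k[n.+1]}.
Local Notation L := (linear_form c : R).

Lemma fat_ideal_ideal m : is_ideal (fat_ideal P m).
Proof.
split=> [j|f g hf hg j|a f hf j].
- exact: (ideal0 (ideal_gen_ideal _)).
- by apply: (idealD (ideal_gen_ideal _)); [apply: hf|apply: hg].
- by apply: (ideal_mull (ideal_gen_ideal _)); apply: hf.
Qed.

Lemma fat_ideal_pihomog m t f : fat_ideal P m f -> fat_ideal P m (pihomog t f).
Proof.
move=> hf j; have [A [uA A_P _]] := adapted_matrix c0 (cP j) erefl.
apply/(ideal_pow_vdeg uA A_P); rewrite lin_subst_pihomog.
by apply/supp_in_pihomog/(ideal_pow_vdeg uA A_P)/hf.
Qed.

(** In coordinates adapted to [P j] the form becomes a nonzero multiple of the first variable, which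
    does not change the order of vanishing. *)
Lemma fat_ideal_sat m f : fat_ideal P m (L * f) -> fat_ideal P m f.
Proof.
move=> hf j; have [A [uA A_P cA]] := adapted_matrix c0 (cP j) erefl.
apply/(ideal_pow_vdeg uA A_P); have /(ideal_pow_vdeg uA A_P) := hf j.
rewrite rmorphM /= lin_subst_linear_form cA linear_formZ linear_form_delta.
move=> /(supp_inZ (c := (\sum_l c 0 l * P j 0 l)^-1)).
rewrite -scalerAl scalerA mulVf // scale1r => /supp_inXM h e /h.
by rewrite vdegD vdeg_U0.
Qed.

Lemma fat_ideal_le m m' f : (forall j, m' j <= m j)%N ->
  fat_ideal P m f -> fat_ideal P m' f.
Proof.
move=> mm' hf j; have [A [uA A_P _]] := adapted_matrix c0 (cP j) erefl.
apply/(ideal_pow_vdeg uA A_P) => e; have /(ideal_pow_vdeg uA A_P) h := hf j.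
by move/h; apply: leq_trans.
Qed.

Variables (m : 'I_s -> nat) (i : 'I_s) (A : 'M[k]_n.+1).
Hypotheses (uA : A \in unitmx) (A_P : forall j, A j 0 = P i 0 j).

(** Orders of vanishing add up at [P i], where [g] supplies the missing one; the other
    multiplicities are unchanged. *)
Lemma fat_ideal_lower f g : supp_in (fun e => 1 <= vdeg e)%N (lin_subst A g) ->
  fat_ideal P (lower_mult m i) f -> fat_ideal P m (g * f).
Proof.
move=> hg hf j; have := hf j; rewrite /lower_mult; case: eqP => [->|_]; last first.
  exact: (ideal_mull (ideal_gen_ideal _)).
move=> /(ideal_pow_vdeg uA A_P) hfi; apply/(ideal_pow_vdeg uA A_P).
rewrite rmorphM /=; apply: supp_inM hg hfi => a b a1 b1.
by rewrite vdegD -leq_subLR (leq_trans _ b1) // leq_sub2l.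
Qed.

Lemma fat_ideal_coord l f : (0 < l <= n)%N ->
  fat_ideal P (lower_mult m i) f -> fat_ideal P m (coord_form A l * f).
Proof.
case: l => // l ln; apply: fat_ideal_lower; rewrite coord_substK //.
have -> : inord l.+1 = lift ord0 (Ordinal ln) :> 'I_n.+1.
  by apply: val_inj; rewrite /= inordK.
by move=> e /mem_msuppXP <-; rewrite vdeg_U.
Qed.

(** The quotient by the ideal of the point is the polynomial ring in [L]; the scalar is the
    coefficient of the pure power of the first variable. *)
Lemma form_mod_point e (g : R) : c *m A = delta_mx 0 0 -> g \is e.-homog ->
  exists a : k, supp_in (fun e => 1 <= vdeg e)%N (lin_subst A (g - a *: L ^+ e)).
Proof.
move=> cA hg; have hAg := lin_subst_homog A hg.
exists (lin_subst A g)@_(U_(ord0) *+ e) => x.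
rewrite linearB linearZ rmorphXn /= lin_subst_linear_form cA linear_form_delta.
rewrite mcoeff_msupp lt0n mpolyXn mcoeffB mcoeffZ mcoeffX.
apply: contraNneq => /vdeg_eq0 xE.
have [de|de] := eqVneq (mdeg x) e; first by rewrite xE de eqxx mulr1 subrr.
rewrite (dhomog_nemf_coeff hAg de).
have [ex|_] := eqVneq (U_(ord0) *+ e)%MM x; last by rewrite mulr0 subrr.
by rewrite -ex mdegMn mdeg1 mul1n eqxx in de.
Qed.

End FatPoints.

Lemma card_res_shift (F : nat -> seq int) p (x : int) : (0 < p)%N ->
  #|[set i | @res_shift F p i == x]| = count_mem x (F p.-1).
Proof.
case: p => // p _; rewrite -[F p.+1.-1]/(tval (in_tuple (F p))) count_tnth.
by congr #|pred_of_set _|; apply/setP => j; rewrite !inE (tnth_nth 0).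
Qed.

Theorem theorem1p1 (k : closedFieldType) (k_char0 : [pchar k] =i pred0)
    (n : nat) (n_gt0 : (0 < n)%N)
    (s : nat) (P : 'I_s -> 'rV[k]_n.+1) (m : 'I_s -> nat)
    (P_neq0 : forall j, P j != 0)
    (P_distinct : forall j l, j != l -> ~ same_point (P j) (P l))
    (m_gt0 : forall j, (0 < m j)%N)
    (i : 'I_s)
    (ds : (num_separators n m i).-tuple nat)
    (ds_degrees : separator_degrees P ds) :
  (forall t : nat,
     first_difference (hilbert (fat_ideal P (lower_mult m i))) t =
     first_difference (hilbert (fat_ideal P m)) t
       - (#|[set j : 'I_(num_separators n m i) | tnth ds j == t]|)%:Z)
  /\
  (forall (F : nat -> seq int)
     (d : forall l, {linear gfree k n (F l.+1) -> gfree k n (F l)})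
     (eps : {linear gfree k n (F 0%N) -> {mpoly k[n.+1]}^o}),
     minimal_resolution (fat_ideal P m) n d eps ->
     exists F' : seq int,
       gfree_iso k n (F n.-1) (F' ++ [seq (dj + n)%N%:Z | dj <- ds])).
Proof.
have [c [c0 cP cPi]] := generic_linear_form i P_neq0.
have [A [uA A_P cA]] := adapted_matrix c0 (oner_neq0 k) cPi.
rewrite scale1r in cA.
have [_ [F0 [[_ F0_sep F0_gen F0_min] F0_homog]]] := ds_degrees.
set I := fat_ideal P m; set I' := fat_ideal P (lower_mult m i).
have I_ideal : is_ideal I by exact: fat_ideal_ideal.
have I'_ideal : is_ideal I' by exact: fat_ideal_ideal.
have F0_I' j : I' (F0 j).
  have [_ Fi _ Fj] := F0_sep j; move=> l; rewrite /lower_mult.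
  by case: eqP => [->|/eqP /Fj].
have I_sub f : I f -> I' f.
  apply: (fat_ideal_le c0 cP) => j; rewrite /lower_mult.
  by case: eqP => // _; apply: leq_subr.
(* The difference lies in the ideal of [P i], and multiplication by that ideal carries [I'] into
   [I]. *)
have form_act e (g : {mpoly k[n.+1]}) : g \is e.-homog ->
    exists a : k, forall j, I ((g - a *: linear_form c ^+ e) * F0 j).
  move=> /(form_mod_point cA)[a ha]; exists a => j.
  exact: fat_ideal_lower uA A_P _ _ ha (F0_I' j).
have coordE : coord_form A 0 = linear_form c.
  apply: (can_inj (lin_substK uA)); rewrite coord_substK // lin_subst_linear_form cA.
  by rewrite linear_form_delta; congr 'X_(_); apply: val_inj; rewrite /= inordK.
have I_homog t f : I f -> I (pihomog t f) by exact: fat_ideal_pihomog c0 cP _ _ _.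
have L_homog := linear_form_homog c.
have L_sat f : I (linear_form c * f) -> I f by exact: fat_ideal_sat c0 cP _ _.
have L_sat' f : I' (linear_form c * f) -> I' f by exact: fat_ideal_sat c0 cP _ _.
have F0_gen' f : I' f -> exists b, I (f - \sum_j b j * F0 j) by move/F0_gen.
split=> [t|F d eps res].
  exact: (first_difference_separators I_ideal I'_ideal I_homog L_homog L_sat
    F0_homog F0_I' I_sub F0_gen' F0_min form_act).
(* It suffices to compare multiplicities: each shift must occur in the last module at least as often
   as among the [dj + n]. *)
have [|F' perm_F] := @count_leq_perm_cat _ (F n.-1) [seq (dj + n)%N%:Z | dj <- ds].
  move=> x; have [x0|/count_memPn ->//] := boolP (x \in [seq (dj + n)%N%:Z | dj <- ds]).
  have [e _ ->] := mapP x0; rewrite -card_res_shift // count_map.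
  rewrite (count_tnth ds) -[X in (X <= _)%N]card_ord; set J := [set j | _].
  have dJ (j : 'I_#|J|) : tnth ds (enum_val j) = e.
    by have := enum_valP j; rewrite inE /= eqz_nat eqn_add2r => /eqP.
  (* Applied to the separators of degree [e]: the other coordinate forms carry them into [I], and
     they are independent modulo [I] and [L] by [separators_indep_mod]. *)
  have := last_module_shifts uA _ res (e := e) (f := fun j : 'I_#|J| => F0 (enum_val j)).
  apply.
  - by rewrite coordE.
  - by move=> j; rewrite -(dJ j).
  - by move=> j l ln; apply: (fat_ideal_coord uA A_P ln (F0_I' _)).
  move=> a g; rewrite coordE => Iag j; have [a' a'E] := extend_enum_val a.
  rewrite -a'E; apply: (separators_indep_mod I_ideal I'_ideal I_homog L_homog
    L_sat L_sat' F0_homog F0_I' I_sub F0_gen' F0_min form_act (t := e) (g := g)) (dJ j).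
  move: Iag; congr (I (_ - _)); transitivity (\sum_(j in J) a' j *: F0 j).
    by rewrite [RHS]big_enum_val; apply: eq_bigr => q _; rewrite a'E.
  by apply: eq_bigl => l; rewrite inE /= eqz_nat eqn_add2r.
by exists F'; apply: perm_gfree_iso.
Qed.
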